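(* There is an absolute constant $C>0$ such that the following holds. Let $h\ge 1$, $\Delta>0$, and let $P\in\mathcal C(h)$ be such that every hole $P_i$ satisfies ${\rm diam}_2(P_i)\le \Delta\cdot{\rm diam}_2(P)$. Then \[\varrho(P)\le C\left(1+\min\{h^{3/4}\Delta,\;h^{1/2}\Delta^{1/2}\}\right).\] In particular, if $\Delta\le c\,h^{-1/3}$ for a constant $c>0$, then $\varrho(P)\le C'h^{1/3}$ with $C'$ depending only on $c$.
   Context: For $h\in\mathbb N$, $\mathcal C(h)$ denotes the family of polygonal domains $P=P_0\setminus\bigcup_{i=1}^h \operatorname{int}(P_i)$, where $P_0$ is a convex polygon in the plane and $P_1,\dots,P_h$ (the holes) are pairwise disjoint convex polygons contained in the interior of $P_0$. For $s,t\in P$, $|st|$ is the Euclidean distance and ${\rm geod}(s,t)$ is the infimum of the Euclidean lengths of polygonal paths from $s$ to $t$ contained in $P$. The Euclidean diameter is ${\rm diam}_2(P)=\sup_{s,t\in P}|st|$, the geodesic diameter is ${\rm diam}_g(P)=\sup_{s,t\in P}{\rm geod}(s,t)$, and the distortion is $\varrho(P)={\rm diam}_g(P)/{\rm diam}_2(P)$. For a hole $P_i$, ${\rm diam}_2(P_i)$ is its Euclidean diameter. *)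

(* Defs.v *)
From Stdlib Require Import Reals List.
From Coquelicot Require Import Coquelicot.
Import ListNotations.
Open Scope R_scope.

Definition pt := (R * R)%type.
Definition region := pt -> Prop.

Definition dist2 (p q : pt) : R :=
  sqrt ((fst p - fst q) ^ 2 + (snd p - snd q) ^ 2).

Definition interior (S : region) (p : pt) : Prop :=
  exists e, 0 < e /\ forall q, dist2 p q < e -> S q.

Definition in_hull (l : list pt) (p : pt) : Prop :=
  exists ws : list R,
    length ws = length l /\ List.Forall (fun w => 0 <= w) ws /\
    fold_right Rplus 0 ws = 1 /\
    fst p = fold_right Rplus 0 (map (fun wq => fst wq * fst (snd wq)) (combine ws l)) /\
    snd p = fold_right Rplus 0 (map (fun wq => fst wq * snd (snd wq)) (combine ws l)).

Definition convex_polygon (S : region) : Prop :=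
  (exists l : list pt, forall p, S p <-> in_hull l p) /\ exists p, interior S p.

(* P0 together with the holes H 1, ..., H h describe a domain of C(h) *)
Definition in_C (h : nat) (P0 : region) (H : nat -> region) : Prop :=
  convex_polygon P0 /\
  (forall i, (1 <= i <= h)%nat -> convex_polygon (H i)) /\
  (forall i, (1 <= i <= h)%nat -> forall p, H i p -> interior P0 p) /\
  (forall i j, (1 <= i <= h)%nat -> (1 <= j <= h)%nat -> i <> j ->
     forall p, ~ (H i p /\ H j p)).

Definition pdomain (h : nat) (P0 : region) (H : nat -> region) : region :=
  fun p => P0 p /\ forall i, (1 <= i <= h)%nat -> ~ interior (H i) p.

Definition on_segment (a b p : pt) : Prop :=
  exists t, 0 <= t <= 1 /\ p = (fst a + t * (fst b - fst a), snd a + t * (snd b - snd a)).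

Fixpoint segs_in (S : region) (a : pt) (l : list pt) : Prop :=
  match l with
  | [] => True
  | b :: l' => (forall p, on_segment a b p -> S p) /\ segs_in S b l'
  end.

Fixpoint path_length (a : pt) (l : list pt) : R :=
  match l with
  | [] => 0
  | b :: l' => dist2 a b + path_length b l'
  end.

(* polygonal path s = x0, x1, ..., xk = t (vertex list l = [x1; ...; xk]) inside S *)
Definition polypath (S : region) (s t : pt) (l : list pt) : Prop :=
  segs_in S s l /\ last l s = t.

Definition geod (S : region) (s t : pt) : Rbar :=
  Glb_Rbar (fun L => exists l, polypath S s t l /\ L = path_length s l).

Definition diam2 (S : region) : Rbar :=
  Lub_Rbar (fun d => exists s t, S s /\ S t /\ d = dist2 s t).

Definition diamg (S : region) : Rbar :=
  Rbar_lub (fun x => exists s t, S s /\ S t /\ x = geod S s t).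

Definition distortion (S : region) : Rbar := Rbar_div (diamg S) (diam2 S).

(* Main.v *)
From Stdlib Require Import Reals List Lra Lia Classical ClassicalEpsilon.
From Coquelicot Require Import Coquelicot.
Require Import Defs.
Import ListNotations.
Open Scope R_scope.

(* For a slope [k], use sheared coordinates: abscissa [x] and height [y - k x].  From a point
   of the domain move right at constant height; on hitting a hole, follow its boundary up to
   its top and go on.  The height never decreases, so only the backward (leftward) moves along
   holes are expensive.  Backward edges whose backward run is at most [m] times their rise cost
   at most [m] times the total rise.  The others have ordinary slope in the window
   [(k - 1/m, k)], so for the slopes [j / m], [1 <= j <= m], they lie over disjoint
   [x]-intervals of each hole, and for some [j] they cost at most [h d / m] in total, where [d]
   bounds the diameters of the holes.  Running this to the outer boundary, with [D] the diameter
   and [m] about [sqrt (h d / D)], gives the second bound.  For the first one, stop at one of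
   [n] levels with spacing [3 d] above the start: each hole meets at most one of them, so some
   level meets at most [h / n] holes and can be followed to the outer boundary with a detour of
   length [O(d)] per hole; take [m = n] about [h^(1/4)].  Finally two points of the outer
   boundary are connected along it. *)

(** * Distances and polygonal paths *)

Definition comb (t : R) (p q : pt) : pt :=
  (fst p + t * (fst q - fst p), snd p + t * (snd q - snd p)).

Lemma pt_eq (p q : pt) : fst p = fst q -> snd p = snd q -> p = q.
Proof. destruct p, q; simpl; congruence. Qed.

Lemma dist2_le_l1 (p q : pt) :
  dist2 p q <= Rabs (fst p - fst q) + Rabs (snd p - snd q).
Proof.
  unfold dist2.
  set (a := fst p - fst q). set (b := snd p - snd q).
  pose proof (Rabs_pos a). pose proof (Rabs_pos b).
  apply Rsqr_incr_0_var; [|lra].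
  unfold Rsqr at 1. rewrite sqrt_sqrt by nra.
  rewrite <- (pow2_abs a), <- (pow2_abs b). unfold Rsqr. nra.
Qed.

Lemma abs_fst_le_dist2 (p q : pt) : Rabs (fst p - fst q) <= dist2 p q.
Proof.
  unfold dist2. rewrite <- sqrt_Rsqr_abs. apply sqrt_le_1_alt.
  pose proof (pow2_ge_0 (snd p - snd q)). unfold Rsqr. lra.
Qed.

Lemma abs_snd_le_dist2 (p q : pt) : Rabs (snd p - snd q) <= dist2 p q.
Proof.
  unfold dist2. rewrite <- sqrt_Rsqr_abs. apply sqrt_le_1_alt.
  pose proof (pow2_ge_0 (fst p - fst q)). unfold Rsqr. lra.
Qed.

Lemma dist2_sym (p q : pt) : dist2 p q = dist2 q p.
Proof. unfold dist2. f_equal. ring. Qed.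

(** Upper bounds on path length add up under concatenation, which spares handling the infimum in
    [geod]; [distortion_le] converts them back at the end. *)
Definition reach (S : region) (a b : pt) (L : R) : Prop :=
  exists l, polypath S a b l /\ path_length a l <= L.

Lemma reach_refl (S : region) (a : pt) : reach S a a 0.
Proof. exists []. repeat split. simpl. lra. Qed.

Lemma reach_le (S : region) (a b : pt) (L L' : R) :
  L <= L' -> reach S a b L -> reach S a b L'.
Proof. intros HL [l [Hp Hl]]. exists l. split; [exact Hp | lra]. Qed.

Lemma reach_mono (S S' : region) (a b : pt) (L : R) :
  (forall p, S p -> S' p) -> reach S a b L -> reach S' a b L.
Proof.
  intros HS [l [[Hs He] Hl]]. exists l. split; [split; [|exact He] | exact Hl].
  clear He Hl. revert a Hs. induction l as [|c l IH]; intros a; simpl; [easy|].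
  intros [H1 H2]. split; auto.
Qed.

Lemma reach_seg (S : region) (a b : pt) :
  (forall t, 0 <= t <= 1 -> S (comb t a b)) -> reach S a b (dist2 a b).
Proof.
  intros HS. exists [b]. repeat split; simpl; [|lra].
  intros p [t [Ht ->]]. exact (HS t Ht).
Qed.

Lemma last_cons_any (l : list pt) (c d : pt) : last (c :: l) d = last l c.
Proof.
  revert c d. induction l as [|x l IH]; intros c d; [easy|].
  change (last (c :: x :: l) d) with (last (x :: l) d).
  rewrite !IH. reflexivity.
Qed.

Lemma reach_trans (S : region) (a b c : pt) (L M : R) :
  reach S a b L -> reach S b c M -> reach S a c (L + M).
Proof.
  intros [l [[Hs He] Hl]] [m [[Hs' He'] Hm]].
  exists (l ++ m).
  revert a L Hs He Hl. induction l as [|x l IH]; intros a L Hs He Hl.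
  - simpl in *. subst a. split; [split; assumption | lra].
  - rewrite last_cons_any in He. destruct Hs as [H1 H2]. simpl in Hl.
    destruct (IH x (L - dist2 a x) H2 He) as [[H3 H4] H5]; [lra|].
    split; [split|].
    + simpl. split; assumption.
    + change ((x :: l) ++ m) with (x :: (l ++ m)). rewrite last_cons_any. exact H4.
    + simpl. lra.
Qed.

Lemma reach_sym (S : region) (a b : pt) (L : R) : reach S a b L -> reach S b a L.
Proof.
  intros [l [[Hs He] Hl]]. apply (reach_le _ _ _ _ _ Hl). clear Hl.
  revert a Hs He. induction l as [|x l IH]; intros a Hs He.
  - simpl in He. subst. apply reach_refl.
  - rewrite last_cons_any in He. destruct Hs as [H1 H2]. simpl.
    rewrite Rplus_comm. apply reach_trans with x; [apply IH; assumption|].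
    rewrite dist2_sym. apply reach_seg. intros t Ht. apply H1.
    exists (1 - t). split; [lra|]. unfold comb; simpl. f_equal; ring.
Qed.

(** * Convex polygons through linear functionals *)

(** All that is kept of a convex hull once [hull_spans] is proved. The last clause reduces a lower
    bound for a linear functional on [S] to the finitely many points of [l]. *)
Definition spans (l : list pt) (S : region) : Prop :=
  (forall p q t, S p -> S q -> 0 <= t <= 1 -> S (comb t p q)) /\
  (forall q, In q l -> S q) /\
  (forall a b c, (forall q, In q l -> c <= a * fst q + b * snd q) ->
     forall p, S p -> c <= a * fst p + b * snd p).

Definition wsum (f : pt -> R) (ws : list R) (l : list pt) : R :=
  fold_right Rplus 0 (map (fun wq => fst wq * f (snd wq)) (combine ws l)).

Lemma in_hull_wsum (l : list pt) (p : pt) :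
  in_hull l p <-> exists ws, length ws = length l /\ List.Forall (fun w => 0 <= w) ws /\
    fold_right Rplus 0 ws = 1 /\ fst p = wsum fst ws l /\ snd p = wsum snd ws l.
Proof. exact (iff_refl _). Qed.

Lemma wsum_cons (f : pt -> R) (w : R) (ws : list R) (q : pt) (l : list pt) :
  wsum f (w :: ws) (q :: l) = w * f q + wsum f ws l.
Proof. reflexivity. Qed.

Fixpoint mix (t : R) (ws vs : list R) : list R :=
  match ws, vs with
  | w :: ws', v :: vs' => (w + t * (v - w)) :: mix t ws' vs'
  | _, _ => []
  end.

Lemma mix_spec (t : R) (l : list pt) : forall ws vs : list R,
  0 <= t <= 1 -> length ws = length l -> length vs = length l ->
  List.Forall (fun w => 0 <= w) ws -> List.Forall (fun w => 0 <= w) vs ->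
  length (mix t ws vs) = length l /\ List.Forall (fun w => 0 <= w) (mix t ws vs) /\
  fold_right Rplus 0 (mix t ws vs) =
    fold_right Rplus 0 ws + t * (fold_right Rplus 0 vs - fold_right Rplus 0 ws) /\
  forall f, wsum f (mix t ws vs) l = wsum f ws l + t * (wsum f vs l - wsum f ws l).
Proof.
  induction l as [|q l IH]; intros [|w ws] [|v vs] Ht Hw Hv Fw Fv; try discriminate.
  - repeat split; [constructor | simpl; ring | intros f; unfold wsum; simpl; ring].
  - inversion Fw; inversion Fv; subst.
    destruct (IH ws vs Ht) as [M1 [M2 [M3 M4]]]; auto.
    split; [simpl; lia|]. split; [constructor; [nra | assumption]|].
    split; [simpl; rewrite M3; ring|].
    intros f. specialize (M4 f). unfold wsum in *. simpl. rewrite M4. ring.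
Qed.

Lemma wsum_ge (a b c : R) (l : list pt) : forall ws : list R,
  length ws = length l -> List.Forall (fun w => 0 <= w) ws ->
  (forall q, In q l -> c <= a * fst q + b * snd q) ->
  c * fold_right Rplus 0 ws <= a * wsum fst ws l + b * wsum snd ws l.
Proof.
  induction l as [|q l IH]; intros [|w ws] Hw Fw Hq; try discriminate.
  - unfold wsum; simpl; lra.
  - inversion Fw; subst. specialize (IH ws).
    assert (Hc : c * fold_right Rplus 0 ws <= a * wsum fst ws l + b * wsum snd ws l).
    { apply IH; auto. intros x Hx. apply Hq. right. exact Hx. }
    specialize (Hq q (or_introl eq_refl)).
    unfold wsum in *; simpl. nra.
Qed.

Lemma in_hull_mem (l : list pt) (q : pt) : In q l -> in_hull l q.
Proof.
  induction l as [|p l IH]; [easy|]. intros [->|Hq]; apply in_hull_wsum.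
  - exists (1 :: repeat 0 (length l)).
    assert (Hz : List.Forall (fun w => 0 <= w) (repeat 0 (length l)) /\
      fold_right Rplus 0 (repeat 0 (length l)) = 0 /\
      forall f, wsum f (repeat 0 (length l)) l = 0).
    { clear. induction l as [|x l [H1 [H2 H3]]]; simpl.
      - repeat split; constructor.
      - split; [constructor; [lra|assumption]|]. split; [lra|].
        intros f. rewrite wsum_cons, H3. ring. }
    destruct Hz as [H1 [H2 H3]].
    rewrite !wsum_cons, !H3. simpl. rewrite repeat_length, H2.
    repeat split; try ring. constructor; [lra|assumption].
  - apply IH, (proj1 (in_hull_wsum l q)) in Hq. destruct Hq as [ws [H1 [H2 [H3 [H4 H5]]]]].
    exists (0 :: ws). rewrite !wsum_cons. simpl. rewrite H1, H3, <- H4, <- H5.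
    repeat split; try ring. constructor; [lra|assumption].
Qed.

Lemma hull_spans (l : list pt) (S : region) :
  (forall p, S p <-> in_hull l p) -> spans l S.
Proof.
  intros HS. split; [|split].
  - intros p q t Hp Hq Ht. apply HS, (proj1 (in_hull_wsum l _)) in Hp, Hq. apply HS, in_hull_wsum.
    destruct Hp as [ws [H1 [H2 [H3 [H4 H5]]]]], Hq as [vs [K1 [K2 [K3 [K4 K5]]]]].
    destruct (mix_spec t l ws vs Ht H1 K1 H2 K2) as [M1 [M2 [M3 M4]]].
    exists (mix t ws vs). split; [exact M1|]. split; [exact M2|].
    split; [rewrite M3, H3, K3; ring|].
    rewrite !M4, <- H4, <- H5, <- K4, <- K5. split; reflexivity.
  - intros q Hq. apply HS, in_hull_mem, Hq.
  - intros a b c Hl p Hp. apply HS, (proj1 (in_hull_wsum l p)) in Hp.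
    destruct Hp as [ws [H1 [H2 [H3 [H4 H5]]]]].
    pose proof (wsum_ge a b c l ws H1 H2 Hl) as Hc.
    rewrite H3, <- H4, <- H5 in Hc. lra.
Qed.

(** A short step from [p] against the gradient [(a, b)] would stay in the ball around [p] and lower
    the functional. *)
Lemma not_interior_min (S : region) (a b : R) (p : pt) :
  0 < a * a + b * b ->
  (forall q, S q -> a * fst p + b * snd p <= a * fst q + b * snd q) ->
  ~ interior S p.
Proof.
  intros Hab Hmin [e [He Hball]].
  pose proof (Rabs_pos a). pose proof (Rabs_pos b).
  (* Dividing by [M] makes the step, [e / M] times [(a, b)], shorter than [e] in the l1 norm; the
     summand 1 makes this strict. *)
  set (M := 1 + Rabs a + Rabs b).
  assert (HM : 0 < e / M) by (apply Rdiv_lt_0_compat; unfold M; lra).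
  assert (Hq : S (fst p - e / M * a, snd p - e / M * b)).
  { apply Hball. eapply Rle_lt_trans; [apply dist2_le_l1|]. simpl.
    replace (fst p - (fst p - e / M * a)) with (e / M * a) by ring.
    replace (snd p - (snd p - e / M * b)) with (e / M * b) by ring.
    rewrite !Rabs_mult, (Rabs_right (e / M)) by lra.
    assert (e = e / M * M) by (field; unfold M; lra).
    unfold M in *. nra. }
  apply Hmin in Hq. simpl in Hq. nra.
Qed.

(** The homothety with centre [p] and ratio [t] maps the ball of radius [e] around [z] to the ball
    of radius [t * e] around [comb t p z]. *)
Lemma interior_comb (l : list pt) (S : region) (p z : pt) (t : R) :
  spans l S -> S p -> interior S z -> 0 < t <= 1 -> interior S (comb t p z).
Proof.
  intros [Hc _] Hp [e [He Hball]] Ht.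
  exists (t * e). split; [nra|]. intros q Hq.
  (* The preimage of [q] under this homothety. *)
  set (z' := (fst z + (fst q - fst (comb t p z)) / t,
              snd z + (snd q - snd (comb t p z)) / t)).
  assert (Hz' : S z').
  { apply Hball.
    assert (Hd : dist2 z z' = dist2 (comb t p z) q / t).
    { unfold dist2.
      replace ((fst z - fst z') ^ 2 + (snd z - snd z') ^ 2) with
        (((fst (comb t p z) - fst q) ^ 2 + (snd (comb t p z) - snd q) ^ 2) / (t * t))
        by (unfold z'; simpl; field; lra).
      rewrite sqrt_div_alt by nra. rewrite sqrt_square by lra. reflexivity. }
    rewrite Hd. apply (Rmult_lt_reg_r t); [lra|].
    unfold Rdiv. rewrite Rmult_assoc, Rinv_l by lra. lra. }
  replace q with (comb t p z'); [apply Hc; auto; lra|].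
  apply pt_eq; unfold z', comb; simpl; field; lra.
Qed.

(** * Supporting lines in sheared coordinates *)

(** The sign [e], used with [e * e = 1], lets one argument treat both sides of a polygon: the left
    for [e = 1] and, by reflection, the right for [e = -1]. *)
Definition xs (e : R) (p : pt) : R := e * fst p.
Definition ht (k : R) (p : pt) : R := snd p - k * fst p.

(** A supporting line of [S] through [a], with [S] on the side of larger [xs e]. Here [s] is an
    inverse slope, the change of [xs e] per unit of sheared height, so lines of constant height are
    excluded. *)
Definition supp (e k : R) (S : region) (a : pt) (s : R) : Prop :=
  forall q, S q -> xs e a - s * ht k a <= xs e q - s * ht k q.

Definition bd (S : region) : region := fun p => S p /\ ~ interior S p.

Lemma xs_comb (e t : R) (p q : pt) :
  xs e (comb t p q) = xs e p + t * (xs e q - xs e p).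
Proof. unfold xs, comb; simpl; ring. Qed.

Lemma ht_comb (k t : R) (p q : pt) :
  ht k (comb t p q) = ht k p + t * (ht k q - ht k p).
Proof. unfold ht, comb; simpl; ring. Qed.

Lemma abs_unit (e : R) : e * e = 1 -> Rabs e = 1.
Proof.
  intros He. destruct (Rmult_integral (e - 1) (e + 1)); [lra| |];
    unfold Rabs; destruct Rcase_abs; lra.
Qed.

(** The vertical displacement is at most the change of height plus [k] times the horizontal
    displacement; hence the factor 2, which reappears in [gauge]. *)
Lemma dist2_le_sheared (e k : R) (p q : pt) :
  e * e = 1 -> 0 <= k <= 1 ->
  dist2 p q <= 2 * Rabs (xs e p - xs e q) + Rabs (ht k p - ht k q).
Proof.
  intros He Hk. eapply Rle_trans; [apply dist2_le_l1|].
  assert (Hx : Rabs (xs e p - xs e q) = Rabs (fst p - fst q)).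
  { unfold xs. replace (e * fst p - e * fst q) with (e * (fst p - fst q)) by ring.
    rewrite Rabs_mult, abs_unit by exact He. ring. }
  rewrite Hx. unfold ht.
  set (X := fst p - fst q).
  replace (snd p - k * fst p - (snd q - k * fst q)) with (snd p - snd q - k * X)
    by (unfold X; ring).
  set (Y := snd p - snd q).
  assert (Rabs Y <= Rabs (Y - k * X) + Rabs (k * X)).
  { replace Y with ((Y - k * X) + k * X) at 1 by ring. apply Rabs_triang. }
  assert (Rabs (k * X) <= Rabs X).
  { rewrite Rabs_mult, (Rabs_right k) by lra. pose proof (Rabs_pos X). nra. }
  lra.
Qed.

Lemma abs_ht_le (k d : R) (p q : pt) :
  0 <= k <= 1 -> dist2 p q <= d -> Rabs (ht k p - ht k q) <= 2 * d.
Proof.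
  intros Hk Hd. pose proof (abs_fst_le_dist2 p q). pose proof (abs_snd_le_dist2 p q).
  unfold ht.
  replace (snd p - k * fst p - (snd q - k * fst q))
    with ((snd p - snd q) + - (k * (fst p - fst q))) by ring.
  eapply Rle_trans; [apply Rabs_triang|].
  rewrite Rabs_Ropp, Rabs_mult, (Rabs_right k) by lra.
  pose proof (Rabs_pos (fst p - fst q)). nra.
Qed.

Lemma abs_xs_le (e d : R) (p q : pt) :
  e * e = 1 -> dist2 p q <= d -> Rabs (xs e p - xs e q) <= d.
Proof.
  intros He Hd. pose proof (abs_fst_le_dist2 p q).
  unfold xs. replace (e * fst p - e * fst q) with (e * (fst p - fst q)) by ring.
  rewrite Rabs_mult, abs_unit by exact He. lra.
Qed.

Lemma supp_bd (e k s : R) (S : region) (a : pt) :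
  e * e = 1 -> S a -> supp e k S a s -> bd S a.
Proof.
  intros He Ha Hs. split; [exact Ha|].
  (* These are the coefficients of [xs e - s * ht k] in the original coordinates. They do not both
     vanish, since [s = 0] leaves [e]. *)
  apply not_interior_min with (e + s * k) (- s).
  - destruct (Req_dec s 0) as [->|Hn]; [nra|].
    assert (0 < s * s) by (apply Rsqr_pos_lt in Hn; exact Hn).
    pose proof (Rle_0_sqr (e + s * k)) as H0. unfold Rsqr in H0. nra.
  - intros q Hq. specialize (Hs q Hq). unfold xs, ht in Hs. nra.
Qed.

Lemma top_bd (k : R) (S : region) (a : pt) :
  S a -> (forall q, S q -> ht k q <= ht k a) -> bd S a.
Proof.
  intros Ha Ht. split; [exact Ha|].
  apply not_interior_min with k (-1); [nra|].
  intros q Hq. specialize (Ht q Hq). unfold ht in Ht. lra.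
Qed.

Lemma supp_of_list (l : list pt) (e k s : R) (S : region) (a : pt) :
  spans l S ->
  (forall q, In q l -> xs e a - s * ht k a <= xs e q - s * ht k q) ->
  supp e k S a s.
Proof.
  intros [_ [_ HS]] Hl q Hq.
  assert (H := HS (e + s * k) (- s) (xs e a - s * ht k a)).
  assert (xs e a - s * ht k a <= (e + s * k) * fst q + - s * snd q).
  { apply H; [|exact Hq]. intros p Hp. specialize (Hl p Hp).
    unfold xs, ht in *. lra. }
  unfold xs, ht in *. lra.
Qed.

Lemma list_min (A : Type) (l : list A) (P : A -> Prop) (F : A -> R) :
  (exists a, In a l /\ P a) ->
  exists a, In a l /\ P a /\ forall b, In b l -> P b -> F a <= F b.
Proof.
  induction l as [|x l IH]; intros [a [Ha HPa]]; [easy|].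
  destruct (classic (exists a, In a l /\ P a)) as [Hex|Hno].
  - destruct (IH Hex) as [y [Hy [Py Hm]]].
    destruct (classic (P x /\ F x <= F y)) as [[Px Hx]|Hn].
    + exists x. split; [left; reflexivity|]. split; [exact Px|].
      intros b [<-|Hb] Pb; [lra|]. specialize (Hm b Hb Pb). lra.
    + exists y. split; [right; exact Hy|]. split; [exact Py|].
      intros b [<-|Hb] Pb; [|auto].
      destruct (Rle_dec (F x) (F y)); [exfalso; tauto|lra].
  - assert (a = x) as ->.
    { destruct Ha as [->|Ha]; [reflexivity|]. exfalso. eauto. }
    exists x. split; [left; reflexivity|]. split; [exact HPa|].
    intros b [<-|Hb] Pb; [lra|]. exfalso. eauto.
Qed.

Lemma list_bound (A : Type) (l : list A) (F : A -> R) :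
  exists M, forall a, In a l -> F a <= M.
Proof.
  induction l as [|x l [M HM]]; [exists 0; easy|].
  exists (Rmax M (F x)). intros a [<-|Ha]; [apply Rmax_r|].
  eapply Rle_trans; [apply HM, Ha|apply Rmax_l].
Qed.

(* The second clause says that the segment from [q] up to [p] passes to the right of [a]. *)
Definition leftmost_on (e k : R) (l : list pt) (a : pt) : Prop :=
  (forall q, In q l -> ht k q = ht k a -> xs e a <= xs e q) /\
  (forall p q, In p l -> In q l -> ht k q < ht k a -> ht k a < ht k p ->
     0 <= (ht k p - ht k a) * (xs e q - xs e a) + (ht k a - ht k q) * (xs e p - xs e a)).

Lemma supp_leftmost_on (e k s : R) (l : list pt) (S : region) (a : pt) :
  spans l S -> supp e k S a s -> leftmost_on e k l a.
Proof.
  intros [_ [HlS _]] Hs. split.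
  - intros q Hq Hh. specialize (Hs q (HlS q Hq)). rewrite Hh in Hs. lra.
  - intros p q Hp Hq Hlq Hlp.
    pose proof (Hs p (HlS p Hp)). pose proof (Hs q (HlS q Hq)). nra.
Qed.

(* A step of gift wrapping: take the vertex above [a] of least inverse slope. *)
Lemma leftmost_step (e k : R) (l : list pt) (a : pt) :
  leftmost_on e k l a -> (exists p, In p l /\ ht k a < ht k p) ->
  exists p s, In p l /\ ht k a < ht k p /\
    xs e p - xs e a = s * (ht k p - ht k a) /\
    forall q, In q l -> xs e a - s * ht k a <= xs e q - s * ht k q.
Proof.
  intros [Hlev Hcr] Hex.
  destruct (list_min _ l (fun p => ht k a < ht k p)
    (fun p => (xs e p - xs e a) / (ht k p - ht k a)) Hex) as [p [Hp [Hap Hm]]].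
  set (s := (xs e p - xs e a) / (ht k p - ht k a)) in *.
  assert (Hs : xs e p - xs e a = s * (ht k p - ht k a)) by (unfold s; field; lra).
  exists p, s. repeat split; auto.
  intros q Hq. destruct (Rtotal_order (ht k q) (ht k a)) as [Hlt|[Heq|Hgt]].
  - specialize (Hcr p q Hp Hq Hlt Hap). rewrite Hs in Hcr.
    (* Substituting the inverse slope of [p] lets the positive factor [ht k p - ht k a] come out of
       the crossing condition. *)
    assert (0 <= (ht k p - ht k a) * (xs e q - xs e a + (ht k a - ht k q) * s)) by lra.
    destruct (Rle_dec 0 (xs e q - xs e a + (ht k a - ht k q) * s)); [lra|]. nra.
  - specialize (Hlev q Hq Heq). rewrite Heq. lra.
  - specialize (Hm q Hq Hgt).
    assert (xs e q - xs e a = (xs e q - xs e a) / (ht k q - ht k a) * (ht k q - ht k a))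
      by (field; lra).
    nra.
Qed.

(** Below the top level, the gift-wrapping slope supports at [a]. On the top level, any [s] at least
    as large as all quotients towards lower vertices does. *)
Lemma leftmost_supp (e k : R) (l : list pt) (S : region) (a : pt) :
  spans l S -> leftmost_on e k l a -> exists s, supp e k S a s.
Proof.
  intros HS Hlm.
  destruct (classic (exists p, In p l /\ ht k a < ht k p)) as [Hex|Hno].
  - destruct (leftmost_step e k l a Hlm Hex) as [p [s [_ [_ [_ Hs]]]]].
    exists s. apply (supp_of_list l); assumption.
  (* Vertices level with [a] contribute meaningless quotients, which can only raise the bound
     [s]. *)
  - destruct (list_bound _ l (fun q => (xs e q - xs e a) / (ht k q - ht k a))) as [s Hs].
    exists s. apply (supp_of_list l); [assumption|]. intros q Hq.
    destruct (Rtotal_order (ht k q) (ht k a)) as [Hlt|[Heq|Hgt]].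
    + specialize (Hs q Hq). simpl in Hs.
      assert (xs e q - xs e a = (xs e q - xs e a) / (ht k q - ht k a) * (ht k q - ht k a))
        by (field; lra).
      nra.
    + pose proof (proj1 Hlm q Hq Heq). rewrite Heq. lra.
    + exfalso. eauto.
Qed.

Lemma exists_list_ge (k : R) (l : list pt) (S : region) (z : pt) :
  spans l S -> S z -> exists q, In q l /\ ht k z <= ht k q.
Proof.
  intros [_ [_ HS]] Hz. apply NNPP. intros Hno.
  destruct (classic (exists q, In q l /\ True)) as [Hne|He].
  - destruct (list_min _ l (fun _ => True) (fun q => - ht k q) Hne) as [q [Hq [_ Hm]]].
    assert (ht k q < ht k z) by (apply Rnot_le_lt; eauto).
    specialize (HS k (-1) (- ht k q)).
    assert (- ht k q <= k * fst z + -1 * snd z).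
    { apply HS; [|exact Hz]. intros p Hp. specialize (Hm p Hp I). unfold ht in *. lra. }
    unfold ht in *. lra.
  (* Without vertices every lower bound holds vacuously, so the zero functional would be at least 1
     on [S]. *)
  - specialize (HS 0 0 1). assert (1 <= 0 * fst z + 0 * snd z); [|lra].
    apply HS; [|exact Hz]. intros p Hp. exfalso. eauto.
Qed.

Lemma exists_list_le (k : R) (l : list pt) (S : region) (z : pt) :
  spans l S -> S z -> exists q, In q l /\ ht k q <= ht k z.
Proof.
  intros [_ [_ HS]] Hz. apply NNPP. intros Hno.
  destruct (classic (exists q, In q l /\ True)) as [Hne|He].
  - destruct (list_min _ l (fun _ => True) (fun q => ht k q) Hne) as [q [Hq [_ Hm]]].
    assert (ht k z < ht k q) by (apply Rnot_le_lt; eauto).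
    specialize (HS (- k) 1 (ht k q)).
    assert (ht k q <= - k * fst z + 1 * snd z).
    { apply HS; [|exact Hz]. intros p Hp. specialize (Hm p Hp I). unfold ht in *. lra. }
    unfold ht in *. lra.
  - specialize (HS 0 0 1). assert (1 <= 0 * fst z + 0 * snd z); [|lra].
    apply HS; [|exact Hz]. intros p Hp. exfalso. eauto.
Qed.

(** The extreme point of a level slice is found without compactness, as the extreme one among the
    finitely many crossings of the level with segments between vertices. *)
Lemma level_leftmost (e k : R) (l : list pt) (S : region) (z : pt) :
  spans l S -> S z ->
  exists a s, S a /\ ht k a = ht k z /\ supp e k S a s.
Proof.
  intros HS Hz.
  (* Crossing of a vertex segment with the level of [z]. A segment of constant height contributes
     its first endpoint, and the pairs [(q, q)] contribute the vertices on the level. *)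
  set (cross := fun pq : pt * pt =>
    comb (if Req_EM_T (ht k (fst pq)) (ht k (snd pq)) then 0
          else (ht k z - ht k (fst pq)) / (ht k (snd pq) - ht k (fst pq)))
      (fst pq) (snd pq)).
  set (P := fun pq : pt * pt => ht k (fst pq) <= ht k z <= ht k (snd pq)).
  destruct (list_min _ (list_prod l l) P (fun pq => xs e (cross pq)))
    as [[p0 q0] [Hin [HP Hm]]].
  { destruct (exists_list_le k l S z HS Hz) as [p [Hp Hp']].
    destruct (exists_list_ge k l S z HS Hz) as [q [Hq Hq']].
    exists (p, q). split; [apply in_prod; assumption | split; assumption]. }
  apply in_prod_iff in Hin. destruct Hin as [Hp0 Hq0].
  unfold P in HP; simpl in HP.
  assert (Hh : ht k (cross (p0, q0)) = ht k z).
  { unfold cross; simpl. rewrite ht_comb. destruct Req_EM_T; [lra|field; lra]. }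
  assert (Ha : S (cross (p0, q0))).
  { destruct HS as [Hc [Hl _]]. apply Hc; [apply Hl, Hp0 | apply Hl, Hq0 |]. simpl.
    destruct Req_EM_T; [lra|]. split.
    - apply Rmult_le_pos; [lra|]. left. apply Rinv_0_lt_compat. lra.
    - apply (Rmult_le_reg_r (ht k q0 - ht k p0)); [lra|].
      unfold Rdiv. rewrite Rmult_assoc, Rinv_l; lra. }
  set (a := cross (p0, q0)) in *.
  destruct (leftmost_supp e k l S a HS) as [s Hs]; [|exists a, s; auto].
  split.
  - intros q Hq Hqa. rewrite Hh in Hqa.
    specialize (Hm (q, q)). simpl in Hm.
    assert (Hle : xs e a <= xs e (cross (q, q))).
    { apply Hm; [apply in_prod; assumption | unfold P; simpl; lra]. }
    unfold cross in Hle. simpl in Hle. rewrite xs_comb in Hle. lra.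
  - intros p q Hp Hq Hqa Hpa. rewrite Hh in *.
    assert (Hle : xs e a <= xs e (cross (q, p))).
    { apply Hm; [apply in_prod; assumption | unfold P; simpl; lra]. }
    unfold cross in Hle. simpl in Hle. rewrite xs_comb in Hle.
    destruct Req_EM_T as [E|E]; [lra|].
    set (r := (ht k z - ht k q) / (ht k p - ht k q)) in *.
    assert (r * (ht k p - ht k q) = ht k z - ht k q) by (unfold r; field; lra).
    nra.
Qed.

(** * Climbing along the boundary of a convex polygon *)

(* Edges along which [xs e] decreases by at most [m] per unit of height are paid for by
   the increase of [gauge]; the others incur an extra cost. *)
Definition gauge (e k m : R) (p : pt) : R := 2 * xs e p + (1 + 4 * m) * ht k p.

Definition excess (e m s Lo : R) (a : pt) : R :=
  if Rle_dec (- m) s then 0 else 4 * (xs e a - Lo).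

Lemma supp_slide (e k s : R) (S : region) (a p : pt) :
  supp e k S a s -> xs e p - xs e a = s * (ht k p - ht k a) -> supp e k S p s.
Proof. intros Hs Hp q Hq. specialize (Hs q Hq). lra. Qed.

(** A backward run [r] costs [2 r] and also lowers the term [2 * xs e] of [gauge] by [2 r]. The
    total [4 r] is covered by [4 * m] times the rise if the inverse slope is at least [-m], and by
    the drop of [excess] otherwise. *)
Lemma boundary_edge (e k m s Lo : R) (l : list pt) (S : region) (a p : pt) :
  spans l S -> e * e = 1 -> 0 <= k <= 1 -> 0 <= m ->
  S a -> S p -> supp e k S a s ->
  ht k a <= ht k p -> xs e p - xs e a = s * (ht k p - ht k a) ->
  reach (bd S) a p
    (gauge e k m p - gauge e k m a + (excess e m s Lo a - excess e m s Lo p)).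
Proof.
  intros HS He Hk Hm Ha Hp Hs Hh Hx.
  apply reach_le with (dist2 a p).
  - eapply Rle_trans; [apply (dist2_le_sheared e k); assumption|].
    rewrite (Rabs_left1 (ht k a - ht k p)) by lra.
    unfold gauge, excess.
    set (dv := ht k p - ht k a) in *.
    replace (- (ht k a - ht k p)) with dv by (unfold dv; ring).
    replace (ht k p) with (ht k a + dv) by (unfold dv; ring).
    replace (xs e p) with (xs e a + s * dv) by lra.
    replace (xs e a - (xs e a + s * dv)) with (- (s * dv)) by ring.
    rewrite Rabs_Ropp.
    assert (Hdv : 0 <= dv) by (unfold dv; lra).
    assert (0 <= m * dv) by (apply Rmult_le_pos; assumption).
    destruct (Rle_dec (- m) s).
    + assert (0 <= (s + m) * dv) by (apply Rmult_le_pos; lra).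
      unfold Rabs; destruct Rcase_abs; lra.
    + assert (0 <= - s * dv) by (apply Rmult_le_pos; lra).
      unfold Rabs; destruct Rcase_abs; lra.
  - apply reach_seg. intros t Ht.
    apply (supp_bd e k s); [assumption | apply (proj1 HS); assumption |].
    apply (supp_slide e k s S a); [assumption|].
    rewrite xs_comb, ht_comb. nra.
Qed.

(** Gift wrapping, with [A] containing the vertices still above the current point. Inverse slopes
    increase during the climb, so the long backward edges come first and their extra cost telescopes
    to at most 4 times the distance from the start back to [Lo]. *)
Lemma boundary_climb_aux (e k m Lo c : R) (l : list pt) (S : region) :
  spans l S -> e * e = 1 -> 0 <= k <= 1 -> 0 <= m ->
  (forall a s, S a -> supp e k S a s -> s < - m -> Lo <= xs e a) ->
  forall (n : nat) (A : list pt) (a : pt) (s0 : R),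
  (length A <= n)%nat ->
  (forall q, In q l -> ht k a < ht k q -> In q A) ->
  S a -> supp e k S a s0 -> ht k a <= c ->
  exists b s, S b /\ supp e k S b s /\ ht k a <= ht k b <= c /\
    (ht k b = c \/ forall q, S q -> ht k q <= ht k b) /\
    reach (bd S) a b (gauge e k m b - gauge e k m a + excess e m s0 Lo a).
Proof.
  intros HS He Hk Hm HLo.
  assert (Hpos : forall a s, S a -> supp e k S a s -> 0 <= excess e m s Lo a).
  { intros a s Ha Hs. unfold excess. destruct (Rle_dec (- m) s); [lra|].
    specialize (HLo a s Ha Hs). lra. }
  induction n as [|n IH]; intros A a s0 HA HAl Ha Hs0 Hc.
  all: destruct (classic (ht k a = c \/ forall q, S q -> ht k q <= ht k a)) as [Hst|Hst].
  1, 3: exists a, s0; repeat split; try assumption; try lra;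
    apply reach_le with 0; [specialize (Hpos a s0 Ha Hs0); lra | apply reach_refl].
  all: assert (Hex : exists p, In p l /\ ht k a < ht k p).
  1, 3: apply not_or_and in Hst; destruct Hst as [_ Hst];
    apply not_all_ex_not in Hst; destruct Hst as [z Hz];
    apply imply_to_and in Hz; destruct Hz as [Hz Hz'];
    destruct (exists_list_ge k l S z HS Hz) as [p [Hp Hp']];
    exists p; split; [exact Hp | lra].
  { destruct Hex as [p [Hp Hap]]. specialize (HAl p Hp Hap).
    destruct A; [easy|simpl in HA; lia]. }
  assert (Hac : ht k a < c) by (destruct (Rle_lt_or_eq_dec _ _ Hc); tauto).
  destruct (leftmost_step e k l a (supp_leftmost_on e k s0 l S a HS Hs0) Hex)
    as [p [s [Hp [Hap [Hx Hsl]]]]].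
  assert (Hs : supp e k S a s) by (apply (supp_of_list l); assumption).
  assert (HSp : S p) by (apply (proj1 (proj2 HS)); assumption).
  (* The new supporting line passes through [p], while the old one has [p] on its side of larger
     [xs e]. *)
  assert (Hss : s0 <= s).
  { specialize (Hs0 p HSp).
    assert (0 <= (s - s0) * (ht k p - ht k a)) by lra.
    apply Rnot_lt_le. intros Hlt. nra. }
  assert (Hexc : excess e m s Lo a <= excess e m s0 Lo a).
  { unfold excess at 1. destruct (Rle_dec (- m) s); [apply Hpos; assumption|].
    unfold excess. destruct (Rle_dec (- m) s0); lra. }
  destruct (Rle_dec (ht k p) c) as [Hpc|Hpc].
  - destruct (in_split p A (HAl p Hp Hap)) as [A1 [A2 ->]].
    destruct (IH (A1 ++ A2) p s) as [b [s' [Hb [Hs' [Hhb [Hend Hr]]]]]].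
    + rewrite length_app in *. simpl in HA. lia.
    + intros q Hq Hpq. assert (Hin : In q (A1 ++ p :: A2)) by (apply HAl; [assumption|lra]).
      apply in_app_or in Hin. apply in_or_app.
      destruct Hin as [|[Heq|]]; [auto | subst; lra | auto].
    + assumption.
    + apply (supp_slide e k s S a); assumption.
    + assumption.
    + exists b, s'. repeat split; try assumption; try lra.
      eapply reach_le; [|eapply reach_trans;
        [apply (boundary_edge e k m s Lo l S a p); try assumption; lra | exact Hr]].
      lra.
  (* The next edge would overshoot the level [c], so the climb stops where it crosses this level. *)
  - set (t := (c - ht k a) / (ht k p - ht k a)).
    assert (Ht : 0 <= t <= 1).
    { unfold t. split.
      - apply Rmult_le_pos; [lra|]. left. apply Rinv_0_lt_compat. lra.
      - apply (Rmult_le_reg_r (ht k p - ht k a)); [lra|].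
        unfold Rdiv. rewrite Rmult_assoc, Rinv_l; lra. }
    set (z := comb t a p).
    assert (Hz : S z) by (apply (proj1 HS); assumption).
    assert (Hhz : ht k z = c) by (unfold z; rewrite ht_comb; unfold t; field; lra).
    assert (Hxz : xs e z - xs e a = s * (ht k z - ht k a)).
    { unfold z. rewrite xs_comb, ht_comb. nra. }
    assert (Hsz : supp e k S z s) by (apply (supp_slide e k s S a); assumption).
    exists z, s. split; [assumption|]. split; [assumption|]. split; [lra|].
    split; [left; assumption|].
    eapply reach_le; [|apply (boundary_edge e k m s Lo l S a z); try assumption; lra].
    specialize (Hpos z s Hz Hsz). lra.
Qed.

Lemma boundary_climb (e k m Lo c : R) (l : list pt) (S : region) (a : pt) (s0 : R) :
  spans l S -> e * e = 1 -> 0 <= k <= 1 -> 0 <= m ->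
  (forall a s, S a -> supp e k S a s -> s < - m -> Lo <= xs e a) ->
  S a -> supp e k S a s0 -> ht k a <= c ->
  exists b s, S b /\ supp e k S b s /\ ht k a <= ht k b <= c /\
    (ht k b = c \/ forall q, S q -> ht k q <= ht k b) /\
    reach (bd S) a b (gauge e k m b - gauge e k m a + excess e m s0 Lo a).
Proof.
  intros HS He Hk Hm HLo Ha Hs Hc.
  apply (boundary_climb_aux e k m Lo c l S) with (n := length l) (A := l); auto.
Qed.

(** Climb with [m = 0] towards a level above all of [S]: the gauge rises by at most [2 * d + 2 * d],
    and the excess is at most [4 * d]. *)
Lemma boundary_to_top (e k d s : R) (l : list pt) (S : region) (a : pt) :
  spans l S -> e * e = 1 -> 0 <= k <= 1 ->
  (forall p q, S p -> S q -> dist2 p q <= d) ->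
  S a -> supp e k S a s ->
  exists b, S b /\ (forall q, S q -> ht k q <= ht k b) /\ reach (bd S) a b (8 * d).
Proof.
  intros HS He Hk Hd Ha Hs.
  assert (Hx : forall p q, S p -> S q -> Rabs (xs e p - xs e q) <= d).
  { intros p q Hp Hq. apply abs_xs_le; auto. }
  assert (Hv : forall p q, S p -> S q -> Rabs (ht k p - ht k q) <= 2 * d).
  { intros p q Hp Hq. apply abs_ht_le; auto. }
  assert (Hd0 : 0 <= d).
  { pose proof (Hx a a Ha Ha). pose proof (Rabs_pos (xs e a - xs e a)). lra. }
  destruct (boundary_climb e k 0 (xs e a - d) (ht k a + 2 * d + 1) l S a s)
    as [b [s' [Hb [Hs' [Hh [Hend Hr]]]]]]; try assumption; try lra.
  { intros p s1 Hp _ _. specialize (Hx a p Ha Hp). apply Rabs_le_between in Hx. lra. }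
  exists b. split; [assumption|].
  pose proof (Hv b a Hb Ha) as Hba. apply Rabs_le_between in Hba.
  pose proof (Hx b a Hb Ha) as Hxa. apply Rabs_le_between in Hxa.
  split; [destruct Hend; [lra|assumption]|].
  eapply reach_le; [|exact Hr].
  unfold gauge, excess. destruct (Rle_dec (- 0) s); lra.
Qed.

(** Climb from both points, on whichever side they lie, and join the two tops along the top level:
    [8 * d + d + 8 * d]. *)
Lemma boundary_connect (e e' k d s s' : R) (l : list pt) (S : region) (a a' : pt) :
  spans l S -> e * e = 1 -> e' * e' = 1 -> 0 <= k <= 1 ->
  (forall p q, S p -> S q -> dist2 p q <= d) ->
  S a -> S a' -> supp e k S a s -> supp e' k S a' s' ->
  reach (bd S) a a' (17 * d).
Proof.
  intros HS He He' Hk Hd Ha Ha' Hs Hs'.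
  destruct (boundary_to_top e k d s l S a) as [b [Hb [Htop Hr]]]; try assumption.
  destruct (boundary_to_top e' k d s' l S a') as [b' [Hb' [Htop' Hr']]]; try assumption.
  replace (17 * d) with (8 * d + (d + 8 * d)) by ring.
  apply reach_trans with b; [exact Hr|].
  apply reach_trans with b'; [|apply reach_sym; exact Hr'].
  apply reach_le with (dist2 b b'); [apply Hd; assumption|].
  apply reach_seg. intros t Ht.
  assert (Hbb : ht k b = ht k b').
  { specialize (Htop b' Hb'). specialize (Htop' b Hb). lra. }
  apply (top_bd k); [apply (proj1 HS); assumption|].
  intros q Hq. rewrite ht_comb, <- Hbb. specialize (Htop q Hq). lra.
Qed.

(** * Moving inside the domain *)

Definition holey (h : nat) (P0 : region) (H : nat -> region)
    (l0 : list pt) (ls : nat -> list pt) : Prop :=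
  spans l0 P0 /\
  (forall i, (1 <= i <= h)%nat -> spans (ls i) (H i)) /\
  (forall i, (1 <= i <= h)%nat -> forall p, H i p -> interior P0 p) /\
  (forall i j, (1 <= i <= h)%nat -> (1 <= j <= h)%nat -> i <> j ->
     forall p, ~ (H i p /\ H j p)).

Lemma interior_sub (S : region) (p : pt) : interior S p -> S p.
Proof.
  intros [e [He Hb]]. apply Hb. unfold dist2.
  replace ((fst p - fst p) ^ 2 + (snd p - snd p) ^ 2) with 0 by ring.
  rewrite sqrt_0. exact He.
Qed.

Lemma hole_bd_pdomain (h : nat) (P0 : region) (H : nat -> region)
    (l0 : list pt) (ls : nat -> list pt) (i : nat) (p : pt) :
  holey h P0 H l0 ls -> (1 <= i <= h)%nat -> bd (H i) p -> pdomain h P0 H p.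
Proof.
  intros [_ [_ [Hin Hdis]]] Hi [Hp Hn]. split.
  - apply interior_sub, (Hin i Hi p Hp).
  - intros j Hj Hint. destruct (Nat.eq_dec i j) as [->|Hij]; [auto|].
    apply (Hdis i j Hi Hj Hij p). split; [exact Hp | apply interior_sub, Hint].
Qed.

Lemma outer_bd_pdomain (h : nat) (P0 : region) (H : nat -> region)
    (l0 : list pt) (ls : nat -> list pt) (p : pt) :
  holey h P0 H l0 ls -> bd P0 p -> pdomain h P0 H p.
Proof.
  intros [_ [_ [Hin _]]] [Hp Hn]. split; [exact Hp|].
  intros i Hi Hint. apply Hn, (Hin i Hi), interior_sub, Hint.
Qed.

Lemma level_eq (k : R) (p q : pt) : fst p = fst q -> ht k p = ht k q -> p = q.
Proof. unfold ht. intros Hf Hh. apply pt_eq; [exact Hf|]. rewrite Hf in Hh. lra. Qed.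

Lemma level_comb (k : R) (p q a : pt) :
  ht k p = ht k a -> ht k q = ht k a -> fst p < fst q ->
  comb ((fst a - fst p) / (fst q - fst p)) p q = a.
Proof.
  intros Hp Hq Hlt. apply (level_eq k).
  - unfold comb; simpl. field. lra.
  - rewrite ht_comb, Hp, Hq. ring.
Qed.

(** The segment to [q0] is cut back, one hole of [B] at a time, to the leftmost point [L] of any
    hole whose interior it meets. [L] is not left of [a]: otherwise [a] would lie between [L] and an
    interior point, hence inside the hole. *)
Lemma first_hit (h : nat) (P0 : region) (H : nat -> region)
    (l0 : list pt) (ls : nat -> list pt) (k : R) (a q0 : pt) :
  holey h P0 H l0 ls -> pdomain h P0 H a ->
  P0 q0 -> ht k q0 = ht k a -> fst a <= fst q0 ->
  forall B : list nat, (forall i, In i B -> (1 <= i <= h)%nat) ->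
  exists q, P0 q /\ ht k q = ht k a /\ fst a <= fst q /\
    (forall i, In i B -> forall z, interior (H i) z -> ht k z = ht k a ->
       ~ (fst a <= fst z <= fst q)) /\
    (q = q0 \/ exists i s z, In i B /\ H i q /\ supp 1 k (H i) q s /\
       interior (H i) z /\ ht k z = ht k a /\ fst a <= fst z).
Proof.
  intros Hdom Ha Hq0 Hhq0 Hxq0.
  induction B as [|i B IH]; intros HB.
  { exists q0. repeat split; auto. }
  destruct IH as [q [Hq [Hhq [Hxq [Hfree Hend]]]]]; [intros; apply HB; right; assumption|].
  assert (Hi : (1 <= i <= h)%nat) by (apply HB; left; reflexivity).
  destruct (classic (exists z, interior (H i) z /\ ht k z = ht k a /\ fst a <= fst z <= fst q))
    as [[z [Hz [Hhz Hxz]]]|Hno].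
  - pose proof Hdom as [_ [Hspan [Hin _]]]. specialize (Hspan i Hi).
    destruct (level_leftmost 1 k (ls i) (H i) z Hspan (interior_sub _ _ Hz))
      as [L [s [HL [HhL Hs]]]].
    assert (Hlt : forall z', interior (H i) z' -> ht k z' = ht k a -> fst L < fst z').
    { intros z' Hz' Hhz'. pose proof (Hs z' (interior_sub _ _ Hz')) as Hle.
      unfold xs in Hle. rewrite HhL, Hhz, Hhz' in Hle.
      destruct (Rle_lt_or_eq_dec (fst L) (fst z')) as [Hl|He]; [lra|exact Hl|].
      exfalso. assert (L = z') as -> by (apply (level_eq k); [exact He|lra]).
      apply (proj2 (supp_bd 1 k s (H i) z' ltac:(lra) HL Hs)), Hz'. }
    assert (HaL : fst a <= fst L).
    { apply Rnot_lt_le. intros Hla. pose proof (Hlt z Hz Hhz).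
      apply (proj2 Ha i Hi).
      rewrite <- (level_comb k L z a) by lra.
      apply (interior_comb (ls i)); try assumption. split.
      - apply Rdiv_lt_0_compat; lra.
      - apply (Rmult_le_reg_r (fst z - fst L)); [lra|].
        unfold Rdiv. rewrite Rmult_assoc, Rinv_l; lra. }
    exists L. split; [apply interior_sub, (Hin i Hi), HL|].
    split; [lra|]. split; [exact HaL|]. split.
    + intros j [<-|Hj] y Hy Hhy Hxy.
      * specialize (Hlt y Hy Hhy). lra.
      * apply (Hfree j Hj y Hy Hhy). specialize (Hlt z Hz Hhz). lra.
    + right. exists i, s, z. repeat split; auto; try lra. left; reflexivity.
  - exists q. repeat split; auto.
    + intros j [<-|Hj] y Hy Hhy Hxy; [apply Hno; eauto | apply (Hfree j Hj y); auto].
    + destruct Hend as [|[j [s [z [Hj Hrest]]]]]; [left; assumption|].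
      right. exists j, s, z. split; [right; exact Hj | exact Hrest].
Qed.

(** The ray leaves [P0] on its right side, hence the orientation [-1], and meets a hole on its left
    side, hence [1]. The interior point [z] on the ray serves later to exclude holes already
    passed. *)
Lemma ray_shoot (h : nat) (P0 : region) (H : nat -> region)
    (l0 : list pt) (ls : nat -> list pt) (k : R) (a : pt) :
  holey h P0 H l0 ls -> 0 <= k <= 1 -> pdomain h P0 H a ->
  exists q s, ht k q = ht k a /\ fst a <= fst q /\
    reach (pdomain h P0 H) a q (2 * (fst q - fst a)) /\
    ((P0 q /\ supp (-1) k P0 q s) \/
     exists i z, (1 <= i <= h)%nat /\ H i q /\ supp 1 k (H i) q s /\
       interior (H i) z /\ ht k z = ht k a /\ fst a <= fst z).
Proof.
  intros Hdom Hk Ha. pose proof Hdom as [Hspan0 _].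
  destruct (level_leftmost (-1) k l0 P0 a Hspan0 (proj1 Ha)) as [q0 [s0 [Hq0 [Hh0 Hs0]]]].
  assert (Hx0 : fst a <= fst q0).
  { specialize (Hs0 a (proj1 Ha)). unfold xs in Hs0. rewrite Hh0 in Hs0. lra. }
  destruct (first_hit h P0 H l0 ls k a q0 Hdom Ha Hq0 Hh0 Hx0 (List.seq 1 h))
    as [q [Hq [Hhq [Hxq [Hfree Hend]]]]].
  { intros i Hi. apply in_seq in Hi. lia. }
  assert (Hr : reach (pdomain h P0 H) a q (2 * (fst q - fst a))).
  { apply reach_le with (dist2 a q).
    - eapply Rle_trans; [apply (dist2_le_sheared 1 k); lra|].
      rewrite Hhq. unfold xs. replace (ht k a - ht k a) with 0 by ring.
      rewrite Rabs_R0, Rabs_left1; lra.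
    - apply reach_seg. intros t Ht. split.
      + apply (proj1 Hspan0); [apply Ha | exact Hq | exact Ht].
      + intros i Hi Hint. apply (Hfree i) with (comb t a q); auto.
        * apply in_seq. lia.
        * rewrite ht_comb, Hhq. ring.
        * simpl. nra. }
  destruct Hend as [Heq|[i [s [z [Hi [Hqi Hrest]]]]]].
  - subst q. exists q0, s0. repeat (split; [assumption|]). left. split; assumption.
  - exists q, s. split; [exact Hhq|]. split; [exact Hxq|]. split; [exact Hr|].
    right. exists i, z. apply in_seq in Hi. split; [lia|]. split; assumption.
Qed.

Definition sumf (f : nat -> R) (A : list nat) : R :=
  fold_right (fun i acc => f i + acc) 0 A.

Lemma sumf_split (f : nat -> R) (A1 A2 : list nat) (i : nat) :
  sumf f (A1 ++ i :: A2) = f i + sumf f (A1 ++ A2).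
Proof. induction A1 as [|j A1 IH]; simpl; [reflexivity|]. rewrite IH. ring. Qed.

Lemma sumf_nonneg (f : nat -> R) (A : list nat) :
  (forall i, In i A -> 0 <= f i) -> 0 <= sumf f A.
Proof.
  induction A as [|j A IH]; simpl; intros Hf; [lra|].
  pose proof (Hf j (or_introl eq_refl)).
  assert (0 <= sumf f A) by (apply IH; auto). lra.
Qed.

(** [A] contains the holes not yet climbed over; all others lie at or below the current height. Each
    hole is charged once, at most [4 * w i], and moves to the right are paid for by the increase of
    [gauge]. *)
Lemma climb_aux (h : nat) (P0 : region) (H : nat -> region)
    (l0 : list pt) (ls : nat -> list pt) (k m c : R) (Lo w : nat -> R) :
  holey h P0 H l0 ls -> 0 <= k <= 1 -> 0 <= m ->
  (forall i, (1 <= i <= h)%nat -> 0 <= w i) ->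
  (forall i a s, (1 <= i <= h)%nat -> H i a -> supp 1 k (H i) a s -> s < - m ->
     Lo i <= fst a <= Lo i + w i) ->
  forall (n : nat) (A : list nat) (a : pt),
  (length A <= n)%nat -> (forall i, In i A -> (1 <= i <= h)%nat) ->
  (forall i, (1 <= i <= h)%nat -> ~ In i A -> forall z, H i z -> ht k z <= ht k a) ->
  pdomain h P0 H a -> ht k a <= c ->
  exists b, pdomain h P0 H b /\ ht k a <= ht k b <= c /\
    (ht k b = c \/ exists s, supp (-1) k P0 b s) /\
    reach (pdomain h P0 H) a b
      (gauge 1 k m b - gauge 1 k m a + 4 * sumf w A).
Proof.
  intros Hdom Hk Hm Hw HLo.
  induction n as [|n IH]; intros A a HA HAh Hdead Ha Hc;
    (destruct (ray_shoot h P0 H l0 ls k a Hdom Hk Ha)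
      as [q [s [Hhq [Hxq [Hr [[HP0 Hs]|[i [z [Hi [Hq [Hs [Hz [Hhz Hxz]]]]]]]]]]]]];
    [exists q; split; [apply (outer_bd_pdomain _ _ _ _ _ _ Hdom), (supp_bd (-1) k s); auto; lra|];
     split; [lra|]; split; [right; eauto|];
     eapply reach_le; [|exact Hr];
     assert (0 <= sumf w A) by (apply sumf_nonneg; auto);
     unfold gauge, xs; rewrite Hhq; lra|]);
    (* A hole outside [A] would have its interior point [z] at its greatest height. *)
    (assert (HiA : In i A) by
      (apply NNPP; intros Hn; specialize (Hdead i Hi Hn);
       apply (proj2 (top_bd k (H i) z (interior_sub _ _ Hz)
         ltac:(intros y Hy; rewrite Hhz; auto))), Hz)).
  { destruct A; [easy|simpl in HA; lia]. }
  destruct (in_split i A HiA) as [A1 [A2 ->]].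
  pose proof Hdom as [_ [Hspan _]].
  destruct (boundary_climb 1 k m (Lo i) c (ls i) (H i) q s)
    as [b [s' [Hb [Hs' [Hhb [Hend Hrb]]]]]]; auto; try lra.
  { intros y sy Hy Hsy Hlt. destruct (HLo i y sy Hi Hy Hsy Hlt). unfold xs. lra. }
  assert (HPb : pdomain h P0 H b).
  { apply (hole_bd_pdomain _ _ _ _ _ i _ Hdom Hi), (supp_bd 1 k s'); auto; lra. }
  assert (Hrab : reach (pdomain h P0 H) a b
    (gauge 1 k m b - gauge 1 k m a + 4 * w i)).
  { eapply reach_le; [|eapply reach_trans; [exact Hr|eapply reach_mono; [|exact Hrb]]].
    - unfold excess. destruct (Rle_dec (- m) s).
      + specialize (Hw i Hi). unfold gauge, xs. rewrite Hhq. lra.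
      + destruct (HLo i q s Hi Hq Hs); [lra|]. unfold gauge, xs. rewrite Hhq. lra.
    - intros p Hp. apply (hole_bd_pdomain _ _ _ _ _ i _ Hdom Hi Hp). }
  assert (HA12 : forall j, In j (A1 ++ A2) -> In j (A1 ++ i :: A2)).
  { intros j Hj. apply in_app_or in Hj. apply in_or_app. simpl. tauto. }
  assert (Hsum : 0 <= sumf w (A1 ++ A2)) by (apply sumf_nonneg; auto).
  destruct Hend as [Hend|Htop].
  - exists b. split; [exact HPb|]. split; [lra|]. split; [left; exact Hend|].
    eapply reach_le; [|exact Hrab]. rewrite sumf_split. lra.
  - destruct (IH (A1 ++ A2) b) as [b' [HPb' [Hhb' [Hend' Hr']]]]; auto; try lra.
    + rewrite length_app in *. simpl in HA. lia.
    + intros j Hj Hnj y Hy. destruct (Nat.eq_dec j i) as [->|Hji]; [auto|].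
      assert (ht k y <= ht k a); [|lra].
      apply (Hdead j Hj); [|exact Hy]. intros Hin. apply Hnj.
      apply in_app_or in Hin. apply in_or_app.
      destruct Hin as [|[Heq|]]; auto. congruence.
    + exists b'. split; [exact HPb'|]. split; [lra|]. split; [exact Hend'|].
      eapply reach_le; [|eapply reach_trans; [exact Hrab | exact Hr']].
      rewrite sumf_split. lra.
Qed.

Lemma climb (h : nat) (P0 : region) (H : nat -> region)
    (l0 : list pt) (ls : nat -> list pt) (k m c : R) (Lo w : nat -> R) (a : pt) :
  holey h P0 H l0 ls -> 0 <= k <= 1 -> 0 <= m ->
  (forall i, (1 <= i <= h)%nat -> 0 <= w i) ->
  (forall i a s, (1 <= i <= h)%nat -> H i a -> supp 1 k (H i) a s -> s < - m ->
     Lo i <= fst a <= Lo i + w i) ->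
  pdomain h P0 H a -> ht k a <= c ->
  exists b, pdomain h P0 H b /\ ht k a <= ht k b <= c /\
    (ht k b = c \/ exists s, supp (-1) k P0 b s) /\
    reach (pdomain h P0 H) a b
      (gauge 1 k m b - gauge 1 k m a + 4 * sumf w (List.seq 1 h)).
Proof.
  intros Hdom Hk Hm Hw HLo Ha Hc.
  apply (climb_aux h P0 H l0 ls k m c Lo w) with (n := h); auto.
  - rewrite length_seq. lia.
  - intros i Hi. apply in_seq in Hi. lia.
  - intros i Hi Hn. exfalso. apply Hn, in_seq. lia.
Qed.

(** A real-valued indicator, so that the number of holes met by a level is a [sumf]. *)
Definition meets (k c : R) (S : region) : R :=
  if excluded_middle_informative (exists z, S z /\ ht k z = c) then 1 else 0.

(** Follow the level to the right and pass from the left to the right end of each obstructing hole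
    by [boundary_connect], at cost [17 * d]. Holes outside [A] have their interiors on this level
    strictly behind the current point. *)
Lemma traverse_aux (h : nat) (P0 : region) (H : nat -> region)
    (l0 : list pt) (ls : nat -> list pt) (k d c : R) :
  holey h P0 H l0 ls -> 0 <= k <= 1 -> 0 <= d ->
  (forall i p q, (1 <= i <= h)%nat -> H i p -> H i q -> dist2 p q <= d) ->
  forall (n : nat) (A : list nat) (a : pt),
  (length A <= n)%nat ->
  (forall i, (1 <= i <= h)%nat -> ~ In i A ->
     forall z, interior (H i) z -> ht k z = c -> fst z < fst a) ->
  pdomain h P0 H a -> ht k a = c ->
  exists b s, P0 b /\ supp (-1) k P0 b s /\
    reach (pdomain h P0 H) a b
      (2 * (fst b - fst a) + 17 * d * sumf (fun i => meets k c (H i)) A).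
Proof.
  intros Hdom Hk Hd Hdiam.
  assert (Hm : forall i, 0 <= meets k c (H i)).
  { intros i. unfold meets. destruct excluded_middle_informative; lra. }
  induction n as [|n IH]; intros A a HA Hdead Ha Hc.
  all: destruct (ray_shoot h P0 H l0 ls k a Hdom Hk Ha)
      as [q [s [Hhq [Hxq [Hr [[HP0 Hs]|[i [z [Hi [Hq [Hs [Hz [Hhz Hxz]]]]]]]]]]]]].
  1, 3: exists q, s; split; [exact HP0|]; split; [exact Hs|];
    eapply reach_le; [|exact Hr];
    assert (0 <= d * sumf (fun i => meets k c (H i)) A)
      by (apply Rmult_le_pos; [assumption | apply sumf_nonneg; auto]); lra.
  all: assert (HiA : In i A) by
    (apply NNPP; intros Hn; specialize (Hdead i Hi Hn z Hz); lra).
  { destruct A; [easy|simpl in HA; lia]. }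
  destruct (in_split i A HiA) as [A1 [A2 ->]].
  pose proof Hdom as [_ [Hspan _]]. specialize (Hspan i Hi).
  destruct (level_leftmost (-1) k (ls i) (H i) z Hspan (interior_sub _ _ Hz))
    as [b [s' [Hb [Hhb Hs']]]].
  assert (Hright : forall y, H i y -> ht k y = c -> fst y <= fst b).
  { intros y Hy Hhy. specialize (Hs' y Hy). unfold xs in Hs'.
    replace (ht k y) with (ht k b) in Hs' by lra. lra. }
  assert (Hrab : reach (pdomain h P0 H) a b (2 * (fst q - fst a) + 17 * d)).
  { eapply reach_trans; [exact Hr|].
    eapply reach_mono; [intros p Hp; apply (hole_bd_pdomain _ _ _ _ _ i _ Hdom Hi Hp)|].
    apply (boundary_connect 1 (-1) k d s s' (ls i)); eauto; lra. }
  assert (Hmi : meets k c (H i) = 1).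
  { unfold meets. destruct excluded_middle_informative as [|Hn]; [reflexivity|].
    exfalso. apply Hn. exists z. split; [apply interior_sub, Hz | lra]. }
  (* The detour ends no further left than it began, so the horizontal budget up to [b] covers the
     ray up to [q]. *)
  assert (Hqb : fst q <= fst b) by (apply Hright; [assumption|lra]).
  destruct (IH (A1 ++ A2) b) as [b' [t [HPb' [Ht Hr']]]].
  - rewrite length_app in *. simpl in HA. lia.
  - intros j Hj Hnj y Hy Hhy. destruct (Nat.eq_dec j i) as [->|Hji].
    + destruct (Rle_lt_or_eq_dec (fst y) (fst b)) as [|Heq];
        [apply Hright; [apply interior_sub, Hy|exact Hhy] | assumption |].
      exfalso. assert (y = b) as -> by (apply (level_eq k); [exact Heq|lra]).
      apply (proj2 (supp_bd (-1) k s' (H i) b ltac:(lra) Hb Hs')), Hy.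
    + assert (fst y < fst a); [|lra].
      apply (Hdead j Hj); [|exact Hy|exact Hhy]. intros Hin. apply Hnj.
      apply in_app_or in Hin. apply in_or_app.
      destruct Hin as [|[Heq|]]; auto. congruence.
  - apply (hole_bd_pdomain _ _ _ _ _ i _ Hdom Hi), (supp_bd (-1) k s'); auto; lra.
  - lra.
  - exists b', t. split; [exact HPb'|]. split; [exact Ht|].
    eapply reach_le; [|eapply reach_trans; [exact Hrab | exact Hr']].
    rewrite sumf_split, Hmi. lra.
Qed.

Lemma traverse (h : nat) (P0 : region) (H : nat -> region)
    (l0 : list pt) (ls : nat -> list pt) (k d : R) (a : pt) :
  holey h P0 H l0 ls -> 0 <= k <= 1 -> 0 <= d ->
  (forall i p q, (1 <= i <= h)%nat -> H i p -> H i q -> dist2 p q <= d) ->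
  pdomain h P0 H a ->
  exists b s, P0 b /\ supp (-1) k P0 b s /\
    reach (pdomain h P0 H) a b
      (2 * (fst b - fst a) +
       17 * d * sumf (fun i => meets k (ht k a) (H i)) (List.seq 1 h)).
Proof.
  intros Hdom Hk Hd Hdiam Ha.
  apply (traverse_aux h P0 H l0 ls) with (n := h); auto.
  - rewrite length_seq. lia.
  - intros i Hi Hn. exfalso. apply Hn, in_seq. lia.
Qed.

(** * Choosing the direction and the level *)

Lemma sumf_ge_const (f : nat -> R) (T : R) (A : list nat) :
  (forall i, In i A -> T <= f i) -> INR (length A) * T <= sumf f A.
Proof.
  induction A as [|j A IH]; intros Hf; [simpl; lra|].
  change (length (j :: A)) with (S (length A)). rewrite S_INR. simpl.
  pose proof (Hf j (or_introl eq_refl)).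
  assert (INR (length A) * T <= sumf f A) by (apply IH; intros; apply Hf; right; assumption).
  lra.
Qed.

Lemma sumf_le_const (f : nat -> R) (T : R) (A : list nat) :
  (forall i, In i A -> f i <= T) -> sumf f A <= INR (length A) * T.
Proof.
  induction A as [|j A IH]; intros Hf; [simpl; lra|].
  change (length (j :: A)) with (S (length A)). rewrite S_INR. simpl.
  pose proof (Hf j (or_introl eq_refl)).
  assert (sumf f A <= INR (length A) * T) by (apply IH; intros; apply Hf; right; assumption).
  lra.
Qed.

Lemma sumf_plus (f g : nat -> R) (A : list nat) :
  sumf (fun i => f i + g i) A = sumf f A + sumf g A.
Proof. induction A as [|j A IH]; simpl; [ring|]. rewrite IH. ring. Qed.

Lemma sumf_exchange (f : nat -> nat -> R) (A B : list nat) :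
  sumf (fun i => sumf (f i) B) A = sumf (fun k => sumf (fun i => f i k) A) B.
Proof.
  induction A as [|j A IH]; simpl.
  - induction B as [|b B IHB]; simpl; [reflexivity|]. rewrite <- IHB. ring.
  - rewrite IH, <- sumf_plus. reflexivity.
Qed.

(** After exchanging the sums, the smallest of the [m] column sums is at most their average. *)
Lemma pigeonhole (f : nat -> nat -> R) (A : list nat) (m : nat) (T : R) :
  (1 <= m)%nat -> (forall i, In i A -> sumf (f i) (List.seq 1 m) <= T) ->
  exists j, (1 <= j <= m)%nat /\
    sumf (fun i => f i j) A <= INR (length A) * T / INR m.
Proof.
  intros Hm Hf.
  destruct (list_min _ (List.seq 1 m) (fun _ => True) (fun j => sumf (fun i => f i j) A))
    as [j [Hj [_ Hmin]]].
  { exists 1%nat. split; [apply in_seq; lia | exact I]. }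
  exists j. split; [apply in_seq in Hj; lia|].
  pose proof (sumf_le_const _ T A Hf) as H1. rewrite sumf_exchange in H1.
  pose proof (sumf_ge_const _ _ (List.seq 1 m) (fun i Hi => Hmin i Hi I)) as H2.
  rewrite length_seq in H2.
  assert (0 < INR m) by (apply lt_0_INR; lia).
  apply (Rmult_le_reg_l (INR m)); [assumption|].
  replace (INR m * (INR (length A) * T / INR m)) with (INR (length A) * T) by (field; lra).
  lra.
Qed.

Lemma sumf_telescope (X : nat -> R) (n : nat) : forall a : nat,
  sumf (fun j => X j - X (j - 1)%nat) (List.seq (S a) n) = X (a + n)%nat - X a.
Proof.
  induction n as [|n IH]; intros a; simpl.
  - rewrite Nat.add_0_r. ring.
  - rewrite IH. replace (a - 0)%nat with a by lia.
    replace (S a + n)%nat with (a + S n)%nat by lia. ring.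
Qed.

Lemma exists_lowest (l : list pt) (S : region) (k : R) :
  spans l S -> (exists p, S p) ->
  exists M, S M /\ forall q, S q -> ht k M <= ht k q.
Proof.
  intros HS [p Hp].
  destruct (exists_list_le k l S p HS Hp) as [q [Hq _]].
  destruct (list_min _ l (fun _ => True) (ht k)) as [M [HM [_ Hmin]]]; [eauto|].
  exists M. split; [apply (proj1 (proj2 HS)), HM|].
  intros y Hy. pose proof (proj2 (proj2 HS) (- k) 1 (ht k M)) as Hf.
  assert (ht k M <= - k * fst y + 1 * snd y); [|unfold ht in *; lra].
  apply Hf; [|exact Hy]. intros z Hz. specialize (Hmin z Hz I). unfold ht in *. lra.
Qed.

(* Backward boundary edges of sheared slope below [-m] have ordinary slope between
   [k - 1/m] and [k], hence lie between the lowest points for these two slopes. *)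
Lemma long_backward_between (S : region) (k m s : R) (a M M' : pt) :
  0 < m -> S a -> S M -> S M' ->
  (forall q, S q -> ht k M <= ht k q) ->
  (forall q, S q -> ht (k - / m) M' <= ht (k - / m) q) ->
  supp 1 k S a s -> s < - m -> fst M' <= fst a <= fst M.
Proof.
  intros Hm Ha HM HM' Hlow Hlow' Hs Hlt.
  pose proof (Hs M HM) as H1. pose proof (Hlow a Ha) as H2.
  pose proof (Hs M' HM') as H3. pose proof (Hlow' a Ha) as H4.
  assert (Hh : forall p, ht (k - / m) p = ht k p + / m * fst p).
  { intros p. unfold ht. ring. }
  rewrite !Hh in H4. unfold xs in *.
  split.
  (* If [M'] were to the right of [a], its minimality would make the run from [a] to [M'] at most
     [m * E], while the supporting line at [a] forces a run of at least [- s * E], which is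
     larger. *)
  - apply Rnot_lt_le. intros Hc.
    set (E := ht k a - ht k M') in *.
    assert (HE : / m * (fst M' - fst a) <= E) by (unfold E; lra).
    assert (0 < / m) by (apply Rinv_0_lt_compat; exact Hm).
    assert (0 < E) by nra.
    assert (fst M' - fst a <= m * E).
    { replace (fst M' - fst a) with (m * (/ m * (fst M' - fst a))) by (field; lra). nra. }
    assert (fst M' - fst a >= - s * E) by (unfold E; lra).
    nra.
  - nra.
Qed.

(** Add the two minimality inequalities. This makes the widths in [good_direction] nonnegative. *)
Lemma lowest_monotone (S : region) (k m : R) (M M' : pt) :
  0 < m -> S M -> S M' ->
  (forall q, S q -> ht k M <= ht k q) ->
  (forall q, S q -> ht (k - / m) M' <= ht (k - / m) q) ->
  fst M' <= fst M.
Proof.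
  intros Hm HM HM' Hlow Hlow'.
  pose proof (Hlow M' HM'). pose proof (Hlow' M HM).
  assert (Hh : forall p, ht (k - / m) p = ht k p + / m * fst p).
  { intros p. unfold ht. ring. }
  rewrite !Hh in *. assert (0 < / m) by (apply Rinv_0_lt_compat; exact Hm). nra.
Qed.

(** For each hole take the abscissas of its lowest points for the slopes [j / m], [0 <= j <= m].
    Their increments telescope to at most [d], so by pigeonhole some [j] has total increment at most
    [h * d / m] over all holes; these increments are the widths [w]. *)
Lemma good_direction (h : nat) (P0 : region) (H : nat -> region)
    (l0 : list pt) (ls : nat -> list pt) (d : R) (m : nat) :
  holey h P0 H l0 ls -> (1 <= m)%nat ->
  (forall i, (1 <= i <= h)%nat -> exists p, H i p) ->
  (forall i p q, (1 <= i <= h)%nat -> H i p -> H i q -> dist2 p q <= d) ->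
  exists (k : R) (Lo w : nat -> R), 0 <= k <= 1 /\
    (forall i, (1 <= i <= h)%nat -> 0 <= w i) /\
    (forall i a s, (1 <= i <= h)%nat -> H i a -> supp 1 k (H i) a s -> s < - INR m ->
       Lo i <= fst a <= Lo i + w i) /\
    sumf w (List.seq 1 h) <= INR h * d / INR m.
Proof.
  intros [_ [Hspan _]] Hm Hne Hd.
  assert (Hm0 : 0 < INR m) by (apply lt_0_INR; lia).
  (* The range condition sits under the existential, so that choice applies to all [i]; indices out
     of range receive a dummy point. *)
  assert (Hex : forall i j : nat, exists M, (1 <= i <= h)%nat ->
    H i M /\ forall q, H i q -> ht (INR j / INR m) M <= ht (INR j / INR m) q).
  { intros i j. destruct (classic ((1 <= i <= h)%nat)) as [Hi|Hn].
    - destruct (exists_lowest (ls i) (H i) (INR j / INR m) (Hspan i Hi) (Hne i Hi))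
        as [M HM]. exists M. intros _. exact HM.
    - exists (0, 0). tauto. }
  set (M := fun i j => proj1_sig (constructive_indefinite_description _ (Hex i j))).
  assert (HM : forall i j, (1 <= i <= h)%nat -> H i (M i j) /\
    forall q, H i q -> ht (INR j / INR m) (M i j) <= ht (INR j / INR m) q).
  { intros i j. unfold M. destruct constructive_indefinite_description as [x Hx].
    exact Hx. }
  destruct (pigeonhole (fun i j => fst (M i j) - fst (M i (j - 1)%nat))
    (List.seq 1 h) m d Hm) as [j [Hj Hsum]].
  { intros i Hi. apply in_seq in Hi.
    rewrite (sumf_telescope (fun j => fst (M i j)) m 0).
    assert (Hi' : (1 <= i <= h)%nat) by lia.
    pose proof (Hd i _ _ Hi' (proj1 (HM i (0 + m)%nat Hi')) (proj1 (HM i 0%nat Hi'))) as Hdd.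
    eapply Rle_trans; [|exact Hdd].
    eapply Rle_trans; [apply Rle_abs | apply abs_fst_le_dist2]. }
  rewrite length_seq in Hsum.
  assert (Hk : INR (j - 1) / INR m = INR j / INR m - / INR m).
  { rewrite minus_INR by lia. simpl. field. lra. }
  assert (Hk01 : 0 <= INR j / INR m <= 1).
  { assert (INR j <= INR m) by (apply le_INR; lia). pose proof (pos_INR j). split.
    - apply Rmult_le_pos; [assumption|]. left. apply Rinv_0_lt_compat. exact Hm0.
    - apply (Rmult_le_reg_r (INR m)); [assumption|].
      unfold Rdiv. rewrite Rmult_assoc, Rinv_l; lra. }
  exists (INR j / INR m), (fun i => fst (M i (j - 1)%nat)),
    (fun i => fst (M i j) - fst (M i (j - 1)%nat)).
  split; [exact Hk01|]. split; [|split; [|exact Hsum]].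
  - intros i Hi. destruct (HM i j Hi) as [H1 H2].
    destruct (HM i (j - 1)%nat Hi) as [H3 H4]. rewrite Hk in H4.
    pose proof (lowest_monotone (H i) _ _ _ _ Hm0 H1 H3 H2 H4). lra.
  - intros i a s Hi Ha Hs Hlt. destruct (HM i j Hi) as [H1 H2].
    destruct (HM i (j - 1)%nat Hi) as [H3 H4]. rewrite Hk in H4.
    pose proof (long_backward_between (H i) _ _ s a _ _ Hm0 Ha H1 H3 H2 H4 Hs Hlt). lra.
Qed.

Lemma sumf_at_most_one (f : nat -> R) (A : list nat) :
  NoDup A -> (forall i, f i = 0 \/ f i = 1) ->
  (forall i j, f i = 1 -> f j = 1 -> i = j) -> sumf f A <= 1.
Proof.
  intros Hnd H01 Huniq. induction A as [|i A IH]; [simpl; lra|].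
  inversion Hnd as [|x l Hni Hnd']; subst. specialize (IH Hnd'). simpl.
  destruct (H01 i) as [H0|H1]; [lra|].
  assert (sumf f A <= INR (length A) * 0); [|lra].
  apply sumf_le_const. intros j Hj. destruct (H01 j) as [|Hj1]; [lra|].
  exfalso. apply Hni. rewrite (Huniq i j H1 Hj1). exact Hj.
Qed.

(** A hole has sheared height extent at most [2 * d], less than the spacing [3 * d], so each hole
    adds at most 1 to the total count over the [n] levels. *)
Lemma good_level (h : nat) (H : nat -> region) (k d v : R) (n : nat) :
  0 <= k <= 1 -> 0 < d -> (1 <= n)%nat ->
  (forall i p q, (1 <= i <= h)%nat -> H i p -> H i q -> dist2 p q <= d) ->
  exists c, v <= c <= v + 3 * d * INR n /\
    sumf (fun i => meets k c (H i)) (List.seq 1 h) <= INR h / INR n.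
Proof.
  intros Hk Hd Hn Hdiam.
  destruct (pigeonhole (fun i j => meets k (v + 3 * d * INR j) (H i))
    (List.seq 1 h) n 1 Hn) as [j [Hj Hsum]].
  { intros i Hi. apply in_seq in Hi.
    assert (Hm : forall j, meets k (v + 3 * d * INR j) (H i) = 1 ->
      exists z, H i z /\ ht k z = v + 3 * d * INR j).
    { intros j. unfold meets.
      destruct excluded_middle_informative as [Hz|]; [auto|lra]. }
    apply sumf_at_most_one; [apply seq_NoDup| |].
    - intros j. unfold meets. destruct excluded_middle_informative; auto.
    - intros j1 j2 H1 H2. destruct (Hm j1 H1) as [z1 [Hz1 Hh1]].
      destruct (Hm j2 H2) as [z2 [Hz2 Hh2]].
      assert (Hab := abs_ht_le k d z1 z2 Hk (Hdiam i z1 z2 ltac:(lia) Hz1 Hz2)).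
      rewrite Hh1, Hh2 in Hab. apply Rabs_le_between in Hab.
      destruct (Nat.lt_trichotomy j1 j2) as [Hlt|[Heq|Hlt]]; [|exact Heq|];
        apply le_INR in Hlt; rewrite S_INR in Hlt; nra. }
  rewrite length_seq, Rmult_1_r in Hsum.
  exists (v + 3 * d * INR j). split; [|exact Hsum].
  assert (INR j <= INR n) by (apply le_INR; lia). pose proof (pos_INR j).
  assert (0 <= d * INR j) by (apply Rmult_le_pos; lra). split; [lra|].
  assert (d * INR j <= d * INR n) by (apply Rmult_le_compat_l; lra). lra.
Qed.

(** * Reaching the outer boundary *)

Lemma exit_high (h : nat) (P0 : region) (H : nat -> region)
    (l0 : list pt) (ls : nat -> list pt) (k m D : R) (Lo w : nat -> R) (a : pt) :
  holey h P0 H l0 ls -> 0 <= k <= 1 -> 0 <= m ->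
  (forall i, (1 <= i <= h)%nat -> 0 <= w i) ->
  (forall i a s, (1 <= i <= h)%nat -> H i a -> supp 1 k (H i) a s -> s < - m ->
     Lo i <= fst a <= Lo i + w i) ->
  (forall p q, P0 p -> P0 q -> fst p - fst q <= D /\ ht k p - ht k q <= 2 * D) ->
  pdomain h P0 H a ->
  exists b s, P0 b /\ supp (-1) k P0 b s /\
    reach (pdomain h P0 H) a b
      (2 * D + (1 + 4 * m) * (2 * D) + 4 * sumf w (List.seq 1 h)).
Proof.
  intros Hdom Hk Hm Hw HLo HD Ha.
  destruct (HD a a (proj1 Ha) (proj1 Ha)) as [HD0 _].
  (* This target level exceeds every height in [P0], so the climb can only end on the outer
     boundary. *)
  destruct (climb h P0 H l0 ls k m (ht k a + 2 * D + 1) Lo w a)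
    as [b [Hb [Hh [Hend Hr]]]]; auto; [lra|].
  destruct (HD b a (proj1 Hb) (proj1 Ha)) as [Hx Hv].
  destruct Hend as [|[s Hs]]; [lra|].
  exists b, s. split; [apply Hb|]. split; [exact Hs|].
  eapply reach_le; [|exact Hr]. unfold gauge, xs.
  assert ((1 + 4 * m) * (ht k b - ht k a) <= (1 + 4 * m) * (2 * D))
    by (apply Rmult_le_compat_l; lra).
  lra.
Qed.

(** Climb to a good level, then traverse along it. The horizontal progress of each of the two stages
    costs at most [2 * D], together [4 * D]; the climb may also exit early. *)
Lemma exit_level (h : nat) (P0 : region) (H : nat -> region)
    (l0 : list pt) (ls : nat -> list pt) (k m D d : R) (Lo w : nat -> R)
    (n : nat) (a : pt) :
  holey h P0 H l0 ls -> 0 <= k <= 1 -> 0 <= m ->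
  (forall i, (1 <= i <= h)%nat -> 0 <= w i) ->
  (forall i a s, (1 <= i <= h)%nat -> H i a -> supp 1 k (H i) a s -> s < - m ->
     Lo i <= fst a <= Lo i + w i) ->
  (forall p q, P0 p -> P0 q -> fst p - fst q <= D /\ ht k p - ht k q <= 2 * D) ->
  0 < d -> (1 <= n)%nat ->
  (forall i p q, (1 <= i <= h)%nat -> H i p -> H i q -> dist2 p q <= d) ->
  pdomain h P0 H a ->
  exists b s, P0 b /\ supp (-1) k P0 b s /\
    reach (pdomain h P0 H) a b
      (4 * D + (1 + 4 * m) * (3 * d * INR n) + 4 * sumf w (List.seq 1 h)
       + 17 * d * (INR h / INR n)).
Proof.
  intros Hdom Hk Hm Hw HLo HD Hd Hn Hdiam Ha.
  destruct (HD a a (proj1 Ha) (proj1 Ha)) as [HD0 _].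
  destruct (good_level h H k d (ht k a) n Hk Hd Hn Hdiam) as [c [Hc Hcnt]].
  destruct (climb h P0 H l0 ls k m c Lo w a)
    as [b [Hb [Hh [Hend Hr]]]]; auto; [lra|].
  destruct (HD b a (proj1 Hb) (proj1 Ha)) as [Hx Hv].
  assert (Hcost : gauge 1 k m b - gauge 1 k m a <=
    2 * D + (1 + 4 * m) * (3 * d * INR n)).
  { unfold gauge, xs.
    assert ((1 + 4 * m) * (ht k b - ht k a) <= (1 + 4 * m) * (3 * d * INR n))
      by (apply Rmult_le_compat_l; lra).
    lra. }
  assert (0 <= INR h / INR n).
  { apply Rmult_le_pos; [apply pos_INR|]. left. apply Rinv_0_lt_compat, lt_0_INR. lia. }
  assert (0 <= d * (INR h / INR n)) by (apply Rmult_le_pos; lra).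
  destruct Hend as [Hbc|[s Hs]].
  - destruct (traverse h P0 H l0 ls k d b) as [b' [s [Hb' [Hs Hr']]]]; auto; [lra|].
    exists b', s. split; [exact Hb'|]. split; [exact Hs|].
    eapply reach_le; [|eapply reach_trans; [exact Hr|exact Hr']].
    destruct (HD b' b Hb' (proj1 Hb)) as [Hx' _].
    rewrite Hbc.
    assert (d * sumf (fun i => meets k c (H i)) (List.seq 1 h) <= d * (INR h / INR n))
      by (apply Rmult_le_compat_l; lra).
    lra.
  - exists b, s. split; [apply Hb|]. split; [exact Hs|].
    eapply reach_le; [|exact Hr]. lra.
Qed.

(** A linear functional attains its extremes over [P0] on the outer boundary, which belongs to the
    domain. Hence the diameter of the domain controls the extents of [P0]. *)
Lemma extent_attained (h : nat) (P0 : region) (H : nat -> region)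
    (l0 : list pt) (ls : nat -> list pt) (a b : R) (p q : pt) :
  holey h P0 H l0 ls -> 0 < a * a + b * b -> P0 p -> P0 q ->
  exists p' q', pdomain h P0 H p' /\ pdomain h P0 H q' /\
    a * fst p + b * snd p - (a * fst q + b * snd q) <=
    a * fst p' + b * snd p' - (a * fst q' + b * snd q').
Proof.
  intros Hdom Hab Hp Hq.
  assert (Hmin : forall a b, 0 < a * a + b * b -> exists y, pdomain h P0 H y /\
    forall z, P0 z -> a * fst y + b * snd y <= a * fst z + b * snd z).
  { clear a b Hab. intros a b Hab. pose proof Hdom as [Hspan _].
    destruct (exists_list_le 0 l0 P0 p Hspan Hp) as [x [Hx _]].
    destruct (list_min _ l0 (fun _ => True) (fun y => a * fst y + b * snd y))
      as [y [Hy [_ Hm]]]; [eauto|].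
    assert (Hle : forall z, P0 z -> a * fst y + b * snd y <= a * fst z + b * snd z).
    { intros z Hz. apply (proj2 (proj2 Hspan)); [|exact Hz]. intros; apply Hm; auto. }
    exists y. split; [|exact Hle].
    apply (outer_bd_pdomain _ _ _ _ _ _ Hdom). split.
    - apply (proj1 (proj2 Hspan)), Hy.
    - apply not_interior_min with a b; assumption. }
  destruct (Hmin a b Hab) as [q' [Hq' Hlo]].
  destruct (Hmin (- a) (- b)) as [p' [Hp' Hhi]]; [nra|].
  exists p', q'. split; [exact Hp'|]. split; [exact Hq'|].
  specialize (Hlo q Hq). specialize (Hhi p Hp). lra.
Qed.

Lemma outer_extent (h : nat) (P0 : region) (H : nat -> region)
    (l0 : list pt) (ls : nat -> list pt) (D : R) (p q : pt) :
  holey h P0 H l0 ls ->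
  (forall s t, pdomain h P0 H s -> pdomain h P0 H t -> dist2 s t <= D) ->
  P0 p -> P0 q -> Rabs (fst p - fst q) <= D /\ Rabs (snd p - snd q) <= D.
Proof.
  intros Hdom HD.
  assert (Hone : forall p q, P0 p -> P0 q -> fst p - fst q <= D /\ snd p - snd q <= D).
  { clear p q. intros p q Hp Hq. split.
    - destruct (extent_attained h P0 H l0 ls 1 0 p q) as [p' [q' [Hp' [Hq' Hle]]]];
        auto; [lra|].
      specialize (HD p' q' Hp' Hq'). pose proof (abs_fst_le_dist2 p' q').
      pose proof (Rle_abs (fst p' - fst q')). lra.
    - destruct (extent_attained h P0 H l0 ls 0 1 p q) as [p' [q' [Hp' [Hq' Hle]]]];
        auto; [lra|].
      specialize (HD p' q' Hp' Hq'). pose proof (abs_snd_le_dist2 p' q').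
      pose proof (Rle_abs (snd p' - snd q')). lra. }
  intros Hp Hq. destruct (Hone p q Hp Hq), (Hone q p Hq Hp).
  split; apply Rabs_le; lra.
Qed.

(** Each point exits at cost [E], and [boundary_connect] with diameter bound [2 * D] joins the exits
    at cost [34 * D]. The slope [k] is common to both exits. *)
Lemma reach_via_boundary (h : nat) (P0 : region) (H : nat -> region)
    (l0 : list pt) (ls : nat -> list pt) (k D E : R) (s t : pt) :
  holey h P0 H l0 ls -> 0 <= k <= 1 ->
  (forall p q, P0 p -> P0 q -> dist2 p q <= 2 * D) ->
  (forall a, pdomain h P0 H a -> exists b s, P0 b /\ supp (-1) k P0 b s /\
     reach (pdomain h P0 H) a b E) ->
  pdomain h P0 H s -> pdomain h P0 H t ->
  reach (pdomain h P0 H) s t (34 * D + 2 * E).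
Proof.
  intros Hdom Hk Hd Hexit Hs Ht.
  destruct (Hexit s Hs) as [b [sb [Hb [Hsb Hrb]]]].
  destruct (Hexit t Ht) as [c [sc [Hc [Hsc Hrc]]]].
  replace (34 * D + 2 * E) with (E + (17 * (2 * D) + E)) by ring.
  apply reach_trans with b; [exact Hrb|].
  apply reach_trans with c; [|apply reach_sym; exact Hrc].
  apply reach_mono with (bd P0).
  - intros p Hp. apply (outer_bd_pdomain _ _ _ _ _ _ Hdom Hp).
  - pose proof Hdom as [Hspan _].
    apply (boundary_connect (-1) (-1) k (2 * D) sb sc l0); auto; lra.
Qed.

(** The first bound uses [exit_high]. The second uses [exit_level] with [n = m], where the terms
    [6 d m + 24 d m^2] are rounded up to [30 d m^2]. *)
Lemma two_reach_bounds (h : nat) (P0 : region) (H : nat -> region)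
    (l0 : list pt) (ls : nat -> list pt) (D d : R) (m : nat) (s t : pt) :
  holey h P0 H l0 ls -> 0 < d -> (1 <= m)%nat ->
  (forall i, (1 <= i <= h)%nat -> exists p, H i p) ->
  (forall i p q, (1 <= i <= h)%nat -> H i p -> H i q -> dist2 p q <= d) ->
  (forall s t, pdomain h P0 H s -> pdomain h P0 H t -> dist2 s t <= D) ->
  pdomain h P0 H s -> pdomain h P0 H t ->
  reach (pdomain h P0 H) s t (42 * D + 16 * INR m * D + 8 * (INR h * d / INR m)) /\
  reach (pdomain h P0 H) s t
    (42 * D + 30 * INR m * INR m * d + 42 * (INR h * d / INR m)).
Proof.
  intros Hdom Hd Hm Hne Hdiam HD Hs Ht.
  destruct (good_direction h P0 H l0 ls d m Hdom Hm Hne Hdiam)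
    as [k [Lo [w [Hk [Hw [HLo Hsum]]]]]].
  assert (Hm1 : 1 <= INR m) by (apply (le_INR 1); exact Hm).
  assert (Hext := outer_extent h P0 H l0 ls D).
  assert (HP0 : forall p q, P0 p -> P0 q -> dist2 p q <= 2 * D).
  { intros p q Hp Hq. destruct (Hext p q Hdom HD Hp Hq).
    pose proof (dist2_le_l1 p q). lra. }
  assert (Hrange : forall p q, P0 p -> P0 q ->
    fst p - fst q <= D /\ ht k p - ht k q <= 2 * D).
  { intros p q Hp Hq. destruct (Hext p q Hdom HD Hp Hq) as [H1 H2].
    apply Rabs_le_between in H1. apply Rabs_le_between in H2.
    split; [lra|]. unfold ht. nra. }
  split.
  - eapply reach_le; [|apply (reach_via_boundary h P0 H l0 ls k D
      (2 * D + (1 + 4 * INR m) * (2 * D) + 4 * sumf w (List.seq 1 h))); auto].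
    + lra.
    + intros a Ha. apply (exit_high h P0 H l0 ls k (INR m) D Lo w); auto. lra.
  - eapply reach_le; [|apply (reach_via_boundary h P0 H l0 ls k D
      (4 * D + (1 + 4 * INR m) * (3 * d * INR m) + 4 * sumf w (List.seq 1 h)
       + 17 * d * (INR h / INR m))); auto].
    + assert (d * INR m <= d * INR m * INR m).
      { assert (0 <= d * INR m) by (apply Rmult_le_pos; lra). nra. }
      replace (17 * d * (INR h / INR m)) with (17 * (INR h * d / INR m)) by (field; lra).
      nra.
    + intros a Ha. apply (exit_level h P0 H l0 ls k (INR m) D d Lo w); auto. lra.
Qed.

(** * The distortion bound *)

Lemma in_C_holey (h : nat) (P0 : region) (H : nat -> region) :
  in_C h P0 H -> exists l0 ls, holey h P0 H l0 ls.
Proof.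
  intros [[[l0 Hl0] _] [HH [Hin Hdis]]].
  assert (Hex : forall i : nat, exists l, (1 <= i <= h)%nat -> spans l (H i)).
  { intros i. destruct (classic ((1 <= i <= h)%nat)) as [Hi|Hn].
    - destruct (HH i Hi) as [[l Hl] _]. exists l. intros _. apply hull_spans, Hl.
    - exists []. tauto. }
  exists l0, (fun i => proj1_sig (constructive_indefinite_description _ (Hex i))).
  split; [apply hull_spans, Hl0|]. split; [|split; assumption].
  intros i Hi. destruct constructive_indefinite_description as [l Hl]. exact (Hl Hi).
Qed.

Lemma le_diam2 (S : region) (D : R) (p q : pt) :
  Rbar_le (diam2 S) D -> S p -> S q -> dist2 p q <= D.
Proof.
  intros HD Hp Hq. destruct (Lub_Rbar_correct (fun d => exists s t, S s /\ S t /\ d = dist2 s t))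
    as [Hub _].
  specialize (Hub (dist2 p q) (ex_intro _ p (ex_intro _ q (conj Hp (conj Hq eq_refl))))).
  exact (Rbar_le_trans (dist2 p q) _ D Hub HD).
Qed.

(** Finite because the vertices bound all coordinates; positive because [P0] contains a ball, and
    its horizontal extent is attained in the domain. *)
Lemma diam2_pdomain (h : nat) (P0 : region) (H : nat -> region)
    (l0 : list pt) (ls : nat -> list pt) :
  holey h P0 H l0 ls -> (exists p, interior P0 p) ->
  exists D, 0 < D /\ diam2 (pdomain h P0 H) = Finite D.
Proof.
  intros Hdom [z [e [He Hz]]]. pose proof Hdom as [[_ [_ Hf]] _].
  destruct (list_bound _ l0 (fun p => Rabs (fst p) + Rabs (snd p))) as [M HM].
  assert (HP0 : forall p, P0 p -> Rabs (fst p) <= M /\ Rabs (snd p) <= M).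
  { assert (Hb : forall a b, Rabs a + Rabs b = 1 -> forall p, P0 p ->
      - M <= a * fst p + b * snd p).
    { intros a b Hab. apply Hf. intros q Hq. specialize (HM q Hq). simpl in HM.
      pose proof (Rabs_pos a). pose proof (Rabs_pos b).
      pose proof (Rabs_pos (fst q)). pose proof (Rabs_pos (snd q)).
      pose proof (Rabs_maj2 (a * fst q)) as K1. pose proof (Rabs_maj2 (b * snd q)) as K2.
      rewrite Rabs_mult in K1, K2. nra. }
    assert (R1 : Rabs 1 = 1) by apply Rabs_R1.
    assert (Rm1 : Rabs (-1) = 1) by (rewrite Rabs_left; lra).
    assert (R0 : Rabs 0 = 0) by apply Rabs_R0.
    intros p Hp.
    pose proof (Hb 1 0 ltac:(lra) p Hp). pose proof (Hb (-1) 0 ltac:(lra) p Hp).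
    pose proof (Hb 0 1 ltac:(lra) p Hp). pose proof (Hb 0 (-1) ltac:(lra) p Hp).
    split; apply Rabs_le; lra. }
  assert (Hfin : Rbar_le (diam2 (pdomain h P0 H)) (4 * M)).
  { apply (proj2 (Lub_Rbar_correct _)). intros x [s [t [Hs [Ht ->]]]]. simpl.
    destruct (HP0 s (proj1 Hs)) as [H1 H2]. destruct (HP0 t (proj1 Ht)) as [H3 H4].
    pose proof (dist2_le_l1 s t) as H5.
    pose proof (Rabs_triang (fst s) (- fst t)) as H6. rewrite Rabs_Ropp in H6.
    pose proof (Rabs_triang (snd s) (- snd t)) as H7. rewrite Rabs_Ropp in H7.
    unfold Rminus in H5. lra. }
  assert (Hzz : P0 (fst z + e / 2, snd z)).
  { apply Hz. eapply Rle_lt_trans; [apply dist2_le_l1|]. simpl.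
    replace (fst z - (fst z + e / 2)) with (- (e / 2)) by ring.
    replace (snd z - snd z) with 0 by ring.
    rewrite Rabs_Ropp, Rabs_R0, Rabs_right; lra. }
  assert (Hz0 : P0 z) by (apply interior_sub; exists e; split; assumption).
  destruct (extent_attained h P0 H l0 ls 1 0 _ _ Hdom ltac:(lra) Hzz Hz0)
    as [p [q [Hp [Hq Hpq]]]].
  simpl in Hpq.
  destruct (diam2 (pdomain h P0 H)) as [D| |] eqn:E.
  - exists D. split; [|reflexivity].
    assert (Hd : dist2 p q <= D).
    { apply (le_diam2 (pdomain h P0 H)); auto. rewrite E. apply Rbar_le_refl. }
    pose proof (abs_fst_le_dist2 p q). pose proof (Rle_abs (fst p - fst q)). lra.
  - contradiction.
  - exfalso.
    assert (dist2 p q <= dist2 p q - 1); [|lra].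
    apply (le_diam2 (pdomain h P0 H)); auto. rewrite E. exact I.
Qed.

Lemma distortion_le (S : region) (D K : R) :
  0 < D -> diam2 S = Finite D ->
  (forall s t, S s -> S t -> reach S s t (K * D)) ->
  Rbar_le (distortion S) K.
Proof.
  intros HD HS Hr.
  assert (Hg : Rbar_le (diamg S) (K * D)).
  { unfold diamg, Rbar_lub. destruct Rbar_ex_lub as [x [Hub Hlub]]. simpl. apply Hlub.
    intros y [s [t [Hs [Ht ->]]]].
    destruct (Hr s t Hs Ht) as [l [Hp Hl]].
    apply Rbar_le_trans with (path_length s l); [|exact Hl].
    apply (proj1 (Glb_Rbar_correct _)). exists l. split; [exact Hp|reflexivity]. }
  assert (HDi : 0 < / D) by (apply Rinv_0_lt_compat; exact HD).
  unfold distortion. rewrite HS. unfold Rbar_div, Rbar_inv.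
  destruct (diamg S) as [g| |]; simpl in *.
  - apply (Rmult_le_reg_r D); [exact HD|]. rewrite Rmult_assoc, Rinv_l; lra.
  - contradiction.
  (* If [diamg S] is minus infinity, it remains so after multiplication by the positive [/ D]. *)
  - unfold Rbar_mult, Rbar_mult'.
    destruct (Rle_dec 0 (/ D)) as [Hle|]; [|lra].
    destruct (Rle_lt_or_eq_dec 0 (/ D) Hle); [exact I|lra].
Qed.

Lemma exists_nat_ceil (r : R) : 0 <= r ->
  exists m : nat, (1 <= m)%nat /\ r <= INR m <= r + 1.
Proof.
  intros Hr. destruct (nfloor_ex r Hr) as [n Hn].
  exists (S n). split; [lia|]. rewrite S_INR. lra.
Qed.

Lemma Rpower_ge_1 (h : nat) (x : R) : (1 <= h)%nat -> 0 <= x -> 1 <= Rpower (INR h) x.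
Proof.
  intros Hh Hx. assert (1 <= INR h) by (apply (le_INR 1); exact Hh).
  rewrite <- (Rpower_O (INR h)) by lra. apply Rle_Rpower; assumption.
Qed.

Lemma distortion_bound (h : nat) (Delta : R) (P0 : region) (H : nat -> region) :
  (1 <= h)%nat -> 0 < Delta -> in_C h P0 H ->
  (forall i, (1 <= i <= h)%nat ->
     Rbar_le (diam2 (H i)) (Rbar_mult (Finite Delta) (diam2 (pdomain h P0 H)))) ->
  Rbar_le (distortion (pdomain h P0 H))
    (Finite (200 * (1 + Rmin (Rpower (INR h) (3/4) * Delta)
                             (sqrt (INR h) * sqrt Delta)))).
Proof.
  intros Hh HDelta HC Hdiam.
  destruct (in_C_holey h P0 H HC) as [l0 [ls Hdom]].
  destruct (diam2_pdomain h P0 H l0 ls Hdom (proj2 (proj1 HC))) as [D [HD HDeq]].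
  apply (distortion_le _ D); [exact HD | exact HDeq |].
  intros s t Hs Ht.
  assert (Hd : 0 < Delta * D) by (apply Rmult_lt_0_compat; assumption).
  assert (Hne : forall i, (1 <= i <= h)%nat -> exists p, H i p).
  { intros i Hi. destruct HC as [_ [HH _]]. destruct (HH i Hi) as [_ [p Hp]].
    exists p. apply interior_sub, Hp. }
  assert (Hhd : forall i p q, (1 <= i <= h)%nat -> H i p -> H i q ->
    dist2 p q <= Delta * D).
  { intros i p q Hi. apply le_diam2. specialize (Hdiam i Hi).
    rewrite HDeq in Hdiam. exact Hdiam. }
  assert (HDD : forall s t, pdomain h P0 H s -> pdomain h P0 H t -> dist2 s t <= D).
  { intros p q. apply le_diam2. rewrite HDeq. apply Rbar_le_refl. }
  pose proof (fun m Hm =>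
    two_reach_bounds h P0 H l0 ls D (Delta * D) m s t Hdom Hd Hm Hne Hhd HDD Hs Ht) as Hreach.
  assert (Hh1 : 1 <= INR h) by (apply (le_INR 1); exact Hh).
  unfold Rmin. destruct Rle_dec.
  (* Take [m] to be [q = h^(1/4)] rounded up. The coefficients become 42 for [D] and [120 + 42] for
     [q^3 * Delta * D], both below 200. *)
  - set (q := Rpower (INR h) (1/4)).
    assert (Hq1 : 1 <= q) by (apply Rpower_ge_1; [exact Hh|lra]).
    assert (Hq2 : q * q = Rpower (INR h) (1/2)).
    { unfold q. rewrite <- Rpower_plus. f_equal. lra. }
    assert (Hq3 : Rpower (INR h) (3/4) = q * q * q).
    { rewrite Hq2. unfold q. rewrite <- Rpower_plus. f_equal. lra. }
    assert (Hq4 : INR h = q * q * q * q).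
    { rewrite <- Hq3. unfold q. rewrite <- Rpower_plus.
      replace (3/4 + 1/4) with 1 by lra. rewrite Rpower_1; lra. }
    rewrite Hq3.
    destruct (exists_nat_ceil q ltac:(lra)) as [m [Hm1 Hm]].
    eapply reach_le; [|apply (proj2 (Hreach m Hm1))].
    (* From [m <= q + 1 <= 2 q] and [q^2 <= q^3]. *)
    assert (Hmm : INR m * INR m <= 4 * (q * q * q)) by nra.
    assert (Hhm : INR h * (Delta * D) / INR m <= q * q * q * (Delta * D)).
    { apply (Rmult_le_reg_r (INR m)); [lra|].
      unfold Rdiv. rewrite Rmult_assoc, Rinv_l, Rmult_1_r by lra. rewrite Hq4.
      assert (0 <= q * q * q * (Delta * D)) by (apply Rmult_le_pos; nra). nra. }
    assert (INR m * INR m * (Delta * D) <= 4 * (q * q * q) * (Delta * D))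
      by (apply Rmult_le_compat_r; lra).
    assert (0 <= q * q * q * (Delta * D)) by (apply Rmult_le_pos; nra).
    lra.
  (* Take [m] to be [r = sqrt (h * Delta)] rounded up. The coefficients become 58 for [D] and 24 for
     [r * D]. *)
  - set (r := sqrt (INR h) * sqrt Delta).
    assert (Hr0 : 0 < r) by (apply Rmult_lt_0_compat; apply sqrt_lt_R0; lra).
    assert (Hr2 : r * r = INR h * Delta).
    { unfold r. replace (sqrt (INR h) * sqrt Delta * (sqrt (INR h) * sqrt Delta))
        with ((sqrt (INR h) * sqrt (INR h)) * (sqrt Delta * sqrt Delta)) by ring.
      rewrite !sqrt_sqrt; lra. }
    destruct (exists_nat_ceil r ltac:(lra)) as [m [Hm1 Hm]].
    eapply reach_le; [|apply (proj1 (Hreach m Hm1))].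
    assert (Hhm : INR h * (Delta * D) / INR m <= r * D).
    { apply (Rmult_le_reg_r (INR m)); [lra|].
      unfold Rdiv. rewrite Rmult_assoc, Rinv_l, Rmult_1_r by lra.
      replace (INR h * (Delta * D)) with (r * r * D) by (rewrite Hr2; ring).
      assert (0 <= r * D) by (apply Rmult_le_pos; lra). nra. }
    assert (INR m * D <= (r + 1) * D) by (apply Rmult_le_compat_r; lra).
    assert (0 <= r * D) by (apply Rmult_le_pos; lra).
    lra.
Qed.

Theorem theorem2 :
  (exists C : R, 0 < C /\
    forall (h : nat) (Delta : R) (P0 : region) (H : nat -> region),
      (1 <= h)%nat -> 0 < Delta -> in_C h P0 H ->
      (forall i, (1 <= i <= h)%nat ->
         Rbar_le (diam2 (H i)) (Rbar_mult (Finite Delta) (diam2 (pdomain h P0 H)))) ->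
      Rbar_le (distortion (pdomain h P0 H))
        (Finite (C * (1 + Rmin (Rpower (INR h) (3/4) * Delta)
                               (sqrt (INR h) * sqrt Delta))))) /\
  (forall c : R, 0 < c -> exists C' : R, 0 < C' /\
    forall (h : nat) (Delta : R) (P0 : region) (H : nat -> region),
      (1 <= h)%nat -> 0 < Delta -> Delta <= c * Rpower (INR h) (-(1/3)) ->
      in_C h P0 H ->
      (forall i, (1 <= i <= h)%nat ->
         Rbar_le (diam2 (H i)) (Rbar_mult (Finite Delta) (diam2 (pdomain h P0 H)))) ->
      Rbar_le (distortion (pdomain h P0 H)) (Finite (C' * Rpower (INR h) (1/3)))).
Proof.
  split.
  - exists 200. split; [lra|]. apply distortion_bound.
  - intros c Hc. pose proof (sqrt_lt_R0 c Hc) as Hsc.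
    (* The second term of the minimum suffices: with [g = h^(1/3)] one has [h * Delta <= c * g^2],
       and the summand 1 is absorbed because [1 <= g]. *)
    exists (200 * (1 + sqrt c)). split; [lra|].
    intros h Delta P0 H Hh HDelta HDc HC Hdiam.
    eapply Rbar_le_trans; [apply (distortion_bound h Delta P0 H); assumption|]. simpl.
    assert (Hh1 : 1 <= INR h) by (apply (le_INR 1); exact Hh).
    set (g := Rpower (INR h) (1/3)).
    assert (Hg1 : 1 <= g) by (apply Rpower_ge_1; [exact Hh|lra]).
    rewrite Rpower_Ropp in HDc. fold g in HDc.
    assert (Hg3 : INR h = g * g * g).
    { unfold g. rewrite <- !Rpower_plus.
      replace (1/3 + 1/3 + 1/3) with 1 by lra. rewrite Rpower_1; lra. }
    assert (Hle : sqrt (INR h) * sqrt Delta <= sqrt c * g).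
    { rewrite <- sqrt_mult by lra.
      replace (sqrt c * g) with (sqrt (c * (g * g)))
        by (rewrite sqrt_mult, sqrt_square; nra).
      apply sqrt_le_1_alt. rewrite Hg3.
      replace (c * (g * g)) with (g * g * g * (c * / g)) by (field; lra).
      apply Rmult_le_compat_l; [|exact HDc]. nra. }
    pose proof (Rmin_r (Rpower (INR h) (3/4) * Delta) (sqrt (INR h) * sqrt Delta)).
    lra.
Qed.
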